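(* The integration map $$\int:\mathcal{MH}(\mathcal A)\longrightarrow\mathcal T,\qquad K_\alpha\ast[M_\bullet]\mapsto X^{\widetilde\alpha+\mathbf{dim}\,M_\bullet}\qquad(\alpha\in K(\mathcal A)=\mathbb{Z}^n,\ M_\bullet\in C_2(\mathscr P))$$ is a homomorphism of algebras. In particular, $\int K_\alpha=X^{\widetilde\alpha}$ and $\int\mathbb X_{M\oplus P[1]}=X^{\bar{\mathbf m}-\bar{\mathbf p}}$ for all $\alpha\in\mathbb{Z}^n$, $M\in\mathcal A$, $P\in\mathscr P$, where $\mathbf m,\mathbf p$ are the dimension vectors of $M,P$.
   Context: Let $k=\mathbb{F}_q$, $v=\sqrt q$. Let $A$ be a finite dimensional hereditary $k$-algebra, $\mathcal A$ the category of finite dimensional left $A$-modules, $\mathscr P$ its full subcategory of projectives. $K(\mathcal A)$, of rank $n$, is identified with $\mathbb{Z}^n$ via $\hat M\mapsto\mathbf{dim}\,M$ (dimension vector, i.e. coordinates in the basis of simple modules). For $\alpha\in\mathbb{Z}^n$ put $\widetilde\alpha=\binom{\mathbf 0}{\alpha}$ and $\bar\alpha=\binom{\alpha}{\mathbf 0}$ in $\mathbb{Z}^{2n}$. $C_2(\mathscr P)$ is the category of morphisms $M_\bullet=(M_{-1}\to M_0)$ in $\mathscr P$ (morphisms: commutative squares), an extension-closed subcategory of the abelian category of morphisms in $\mathcal A$. Put $\langle M_\bullet,N_\bullet\rangle=\dim_k\operatorname{Hom}_{C_2(\mathscr P)}(M_\bullet,N_\bullet)-\dim_k\operatorname{Ext}^1_{C_2(\mathscr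 P)}(M_\bullet,N_\bullet)$ and $\mathbf{dim}\,M_\bullet=\binom{\mathbf{dim}\,M_0-\mathbf{dim}\,M_{-1}}{\mathbf{dim}\,M_0}\in\mathbb{Z}^{2n}$. $\mathcal H_{\rm tw}(C_2(\mathscr P))$ is the free $\mathbb{Z}[v,v^{-1}]$-module on isomorphism classes $[M_\bullet]$ with $[M_\bullet]\ast[N_\bullet]=q^{\langle M_\bullet,N_\bullet\rangle}\sum_{[L_\bullet]}\frac{|\operatorname{Ext}^1(M_\bullet,N_\bullet)_{L_\bullet}|}{|\operatorname{Hom}(M_\bullet,N_\bullet)|}[L_\bullet]$, where the subscript $L_\bullet$ denotes extension classes with middle term isomorphic to $L_\bullet$. For $P\in\mathscr P$ let $K_P=(P\xrightarrow{1}P)$, $Z_P=(P\to0)$; for $M\in\mathcal A$ with minimal projective resolution $0\to\Omega_M\xrightarrow{\delta_M}P_M\to M\to0$ let $C_M=(\Omega_M\xrightarrow{\delta_M}P_M)$. The elements $[K_P]$ are central with $[K_P]\ast[M_\bullet]=[K_P\oplus M_\bullet]$, and $\mathcal{MH}(\mathcal A)$ is the localization of $\mathcal H_{\rm tw}(C_2(\mathscr P))$ at all $[K_P]$. For $\alpha=\hat P-\hat Q$ with $P,Q\in\mathscr P$, $K_\alpha=[K_P]\ast[K_Q]^{-1}$. For $M\in\mathcal A$, $P\in\mathscr P$: $\mathbb X_M=K_{-\hat P_M}\ast[C_M]$, $\mathbb X_{P[1]}=[Z_P]$, $\mathbb X_{M\oplus P[1]}=\mathbb X_M\ast\mathbb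 X_{P[1]}$. $\mathcal T$ is the $\mathbb{Z}[v,v^{-1}]$-algebra with basis $\{X^\alpha:\alpha\in\mathbb{Z}^{2n}\}$ and multiplication $X^\alpha\diamond X^\beta=X^{\alpha+\beta}$. *)

(* Defs.v *)
From HB Require Import structures.
From mathcomp Require Import all_boot all_order all_algebra all_field.
From mathcomp Require Import mathcomp_extra boolp classical_sets functions.
From mathcomp Require Import cardinality fsbigop.
From mathcomp Require Import finmap monalg.

Set Implicit Arguments.
Unset Strict Implicit.
Unset Printing Implicit Defensive.

Import Order.TTheory GRing.Theory Num.Theory.
Local Open Scope ring_scope.
Local Open Scope quotient_scope.

(* Sets are classical sets; {set T} is only used for the finite Hom-sets. *)
Local Open Scope classical_set_scope.

(******************************************************************************)
(* The ring Z[v, v^-1], v = sqrt q, as the least subring of the algebraic     *)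
(* complex numbers containing v and v^-1. In its unit ring structure,         *)
(* inversion is the identity on non-units; q = v ^+ 2 is a unit.              *)
(******************************************************************************)

Section LaurentRing.
Context (k : finFieldType).

Definition vroot : algC := sqrtC #|k|%:R.

Definition Zv_pred : {pred algC} := fun x =>
  `[< forall P : {pred algC},
        subring_closed P -> vroot \in P -> vroot^-1 \in P -> x \in P >].

Lemma Zv_subring : subring_closed Zv_pred.
Proof.
split.
- by apply/asboolP => P [].
- move=> x y /asboolP Hx /asboolP Hy; apply/asboolP => P HP Pv PV.
  by case: (HP) => _ HB _; apply: HB; [apply: Hx|apply: Hy].
- move=> x y /asboolP Hx /asboolP Hy; apply/asboolP => P HP Pv PV.
  by case: (HP) => _ _ HM; apply: HM; [apply: Hx|apply: Hy].
Qed.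

HB.instance Definition _ := GRing.isSubringClosed.Build algC Zv_pred Zv_subring.

Record Zv := MkZv { Zv_val : algC; Zv_valP : Zv_val \in Zv_pred }.

HB.instance Definition _ := [isSub for Zv_val].
HB.instance Definition _ := [Choice of Zv by <:].
HB.instance Definition _ := [SubChoice_isSubComNzRing of Zv by <:].

Definition Zv_unit : {pred Zv} := fun x => `[< exists y, y * x = 1 >].
Definition Zv_inv (x : Zv) : Zv := xget x [set y | y * x = 1].

Lemma Zv_mulVx : {in Zv_unit, left_inverse 1 Zv_inv *%R}.
Proof.
move=> x /asboolP [y yx]; rewrite /Zv_inv.
by case: xgetP => [z _ //|/(_ y)].
Qed.

Lemma Zv_unitPl x y : y * x = 1 -> Zv_unit x.
Proof. by move=> yx; apply/asboolP; exists y. Qed.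

Lemma Zv_invr_out : {in [predC Zv_unit], Zv_inv =1 id}.
Proof.
move=> x /negP nux; rewrite /Zv_inv; case: xgetP => // y _ yx.
by case: nux; apply: Zv_unitPl yx.
Qed.

HB.instance Definition _ :=
  GRing.ComNzRing_hasMulInverse.Build Zv Zv_mulVx Zv_unitPl Zv_invr_out.

End LaurentRing.

(******************************************************************************)
(* The group algebra R[G] of an abelian group G written additively: the free  *)
(* R-module on the basis X^a, a in G, with X^a * X^b = X^(a + b).             *)
(******************************************************************************)

Section GroupAlgebra.
Context (R : comNzRingType) (G : zmodType).

Implicit Types (g : {malg R[G]}) (a b : G).

Definition gmul g1 g2 : {malg R[G]} :=
  \sum_(a <- msupp g1) \sum_(b <- msupp g2) << g1@_a * g2@_b *g a + b >>.

Lemma gmulw (d1 d2 : {fset G}) g1 g2 :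
  fsubset (msupp g1) d1 -> fsubset (msupp g2) d2 ->
  gmul g1 g2 = \sum_(a <- d1) \sum_(b <- d2) << g1@_a * g2@_b *g a + b >>.
Proof.
move=> le_d1 le_d2; rewrite /gmul (big_fset_incl _ le_d1) /=.
  apply/eq_bigr=> k1 _; apply/big_fset_incl => // k _ /mcoeff_outdom ->.
  by rewrite mulr0 monalgU0.
move=> k _ /mcoeff_outdom g1k.
by rewrite big1 => // k' _; rewrite g1k mul0r monalgU0.
Qed.

Lemma gmulUU c1 c2 a b :
  gmul << c1 *g a >> << c2 *g b >> = << c1 * c2 *g a + b >>.
Proof. by rewrite (gmulw msuppU_le msuppU_le) !big_seq_fset1 !mcoeffUU. Qed.

Lemma gmulC : commutative gmul.
Proof.
move=> g1 g2; rewrite /gmul exchange_big; apply: eq_bigr => a _.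
by apply: eq_bigr => b _; rewrite mulrC addrC.
Qed.

Lemma gmulDl : left_distributive gmul +%R.
Proof.
move=> g1 g2 g; have le2 := fsubset_refl (msupp g).
rewrite [in RHS](gmulw (fsubsetUl _ (msupp g2)) le2).
rewrite [in RHS](gmulw (fsubsetUr (msupp g1) _) le2).
rewrite (gmulw (msuppD_le _ _) le2) -big_split /=; apply: eq_bigr => a _.
rewrite -big_split /=; apply: eq_bigr => b _.
by rewrite mcoeffD mulrDl monalgUD.
Qed.

Lemma gmulDr : right_distributive gmul +%R.
Proof. by move=> g g1 g2; rewrite !(gmulC g) gmulDl. Qed.

Lemma gmul0g : left_zero 0 gmul.
Proof. by move=> g; rewrite /gmul msupp0 big_seq_fset0. Qed.

Lemma gmulg0 : right_zero 0 gmul.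
Proof. by move=> g; rewrite gmulC gmul0g. Qed.

Lemma gmul_suml I (r : seq I) (F : I -> {malg R[G]}) g :
  gmul (\sum_(i <- r) F i) g = \sum_(i <- r) gmul (F i) g.
Proof. exact: (big_morph (gmul^~ g) (fun _ _ => gmulDl _ _ _) (gmul0g g)). Qed.

Lemma gmul_sumr I (r : seq I) (F : I -> {malg R[G]}) g :
  gmul g (\sum_(i <- r) F i) = \sum_(i <- r) gmul g (F i).
Proof. exact: (big_morph (gmul g) (fun _ _ => gmulDr _ _ _) (gmulg0 g)). Qed.

Lemma gmulA : associative gmul.
Proof.
move=> g1 g2 g3; rewrite (monalgE g1) !gmul_suml; apply: eq_bigr => a _.
rewrite (monalgE g2) gmul_suml !gmul_sumr gmul_suml; apply: eq_bigr => b _.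
rewrite (monalgE g3) !gmul_sumr; apply: eq_bigr => c _.
by rewrite !gmulUU mulrA addrA.
Qed.

Lemma gmul1g : left_id << 0 >> gmul.
Proof.
move=> g; rewrite [in LHS](monalgE g) [RHS]monalgE gmul_sumr.
by apply: eq_bigr => a _; rewrite gmulUU mul1r add0r.
Qed.

Lemma gone_neq0 : << 0 >> != 0 :> {malg R[G]}.
Proof. by rewrite monalgU_eq0 oner_eq0. Qed.

Lemma gscaleAl (c : R) g1 g2 : c *: gmul g1 g2 = gmul (c *: g1) g2.
Proof.
have sE (d : R) g : d *: g = gmul << d *g 0 >> g.
  rewrite [in RHS](monalgE g) gmul_sumr; apply/malgP => a.
  rewrite mcoeffZ [in LHS](monalgE g) !raddf_sum /= big_distrr /=.
  by apply: eq_bigr => b _; rewrite gmulUU add0r !mcoeffU mulrnAr.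
by rewrite !sE gmulA.
Qed.

Definition galg : Type := {malg R[G]}.
HB.instance Definition _ := GRing.Lmodule.on galg.

Definition gmon a : galg := << a >>.

HB.instance Definition _ := GRing.Zmodule_isComNzRing.Build galg
  gmulA gmulC gmul1g gmulDl gone_neq0.

HB.instance Definition _ := GRing.Lmodule_isLalgebra.Build R galg gscaleAl.
HB.instance Definition _ := GRing.Lalgebra_isComAlgebra.Build R galg.

End GroupAlgebra.

(******************************************************************************)
(* Localization of an R-algebra (H, mul, one) at a family s of its elements,  *)
(* by its universal property. The elements are the algebra expressions in     *)
(* the elements of H and in formal inverses of the s i; two expressions are   *)
(* identified when they have the same value in every algebra B over R, for    *)
(* every algebra morphism f : H -> B and every g : I -> B such that g i is    *)
(* the inverse of f (s i). The ring so obtained could a priori be trivial, so *)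
(* it only gets the structures of a pzRingType and of an lmodType.            *)
(******************************************************************************)

Section Localization.
Context (R : comNzRingType) (H : lmodType R).
Context (mul : H -> H -> H) (one : H) (I : Type) (s : I -> H).

Inductive lterm :=
| LGen of H
| LInv of I
| LAdd of lterm & lterm
| LOpp of lterm
| LScale of R & lterm
| LMul of lterm & lterm.

HB.instance Definition _ := gen_eqMixin lterm.
HB.instance Definition _ := gen_choiceMixin lterm.

Definition inverting (B : algType R) (f : H -> B) (g : I -> B) : Prop :=
  [/\ linear f, f one = 1, {morph f : x y / mul x y >-> x * y},
      forall i, f (s i) * g i = 1 & forall i, g i * f (s i) = 1].

Fixpoint leval (B : algType R) (f : H -> B) (g : I -> B) (t : lterm) : B :=
  match t with
  | LGen x => f x
  | LInv i => g i
  | LAdd t1 t2 => leval f g t1 + leval f g t2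
  | LOpp t1 => - leval f g t1
  | LScale c t1 => c *: leval f g t1
  | LMul t1 t2 => leval f g t1 * leval f g t2
  end.

Definition loc_rel (t u : lterm) : Prop :=
  forall (B : algType R) (f : H -> B) (g : I -> B),
    inverting f g -> leval f g t = leval f g u.

Definition loc_relb (t u : lterm) : bool := `[< loc_rel t u >].

Lemma loc_relb_equiv : equiv_class_of loc_relb.
Proof.
split.
- by move=> t; apply/asboolP.
- by move=> t u; apply/asboolP/asboolP => tu B f g fg; rewrite (tu B f g fg).
- move=> u t w /asboolP tu /asboolP uw; apply/asboolP => B f g fg.
  by rewrite (tu B f g fg) (uw B f g fg).
Qed.

Canonical loc_equiv := EquivRelPack loc_relb_equiv.

Definition loc : Type := {eq_quot loc_equiv}.
HB.instance Definition _ := Choice.on loc.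
HB.instance Definition _ := EqQuotient.on loc.

Definition loc_gen (x : H) : loc := \pi_loc (LGen x).
Definition loc_inv (i : I) : loc := \pi_loc (LInv i).

Definition loc_add (x y : loc) : loc := \pi_loc (LAdd (repr x) (repr y)).
Definition loc_opp (x : loc) : loc := \pi_loc (LOpp (repr x)).
Definition loc_scale (c : R) (x : loc) : loc := \pi_loc (LScale c (repr x)).
Definition loc_mul (x y : loc) : loc := \pi_loc (LMul (repr x) (repr y)).

Lemma loc_eqP t u : \pi_loc t = \pi_loc u <-> loc_rel t u.
Proof. by split=> [/eqmodP /asboolP|tu]; [|apply/eqmodP/asboolP]. Qed.

Lemma leval_repr t (B : algType R) (f : H -> B) (g : I -> B) :
  inverting f g -> leval f g (repr (\pi_loc t)) = leval f g t.
Proof. by move=> fg; apply: (proj1 (loc_eqP _ _)) fg; rewrite reprK. Qed.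

Local Ltac loc_law :=
  repeat move=> ?; rewrite /loc_add /loc_opp /loc_scale /loc_mul;
  apply: (proj2 (loc_eqP _ _)) => B f g fg /=;
  match goal with H : inverting _ _ |- _ => rewrite ?(leval_repr _ H) /= end.

Lemma loc_addA : associative loc_add.
Proof. by loc_law; rewrite addrA. Qed.
Lemma loc_addC : commutative loc_add.
Proof. by loc_law; rewrite addrC. Qed.
Lemma loc_add0 : left_id (loc_gen 0) loc_add.
Proof.
move=> x; rewrite -[RHS]reprK; loc_law; case: fg => lf _ _ _ _.
have -> : f 0 = 0 by have := lf (-1) 0 0; rewrite scaler0 addr0 scaleN1r addNr.
by rewrite add0r.
Qed.
Lemma loc_addN : left_inverse (loc_gen 0) loc_opp loc_add.
Proof.
loc_law; case: fg => lf _ _ _ _.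
have -> : f 0 = 0 by have := lf (-1) 0 0; rewrite scaler0 addr0 scaleN1r addNr.
by rewrite addNr.
Qed.

HB.instance Definition _ :=
  GRing.isZmodule.Build loc loc_addA loc_addC loc_add0 loc_addN.

Lemma loc_mulA : associative loc_mul.
Proof. by loc_law; rewrite mulrA. Qed.
Lemma loc_mul1l : left_id (loc_gen one) loc_mul.
Proof.
by move=> x; rewrite -[RHS]reprK; loc_law; case: fg => _ -> _ _ _; rewrite mul1r.
Qed.
Lemma loc_mul1r : right_id (loc_gen one) loc_mul.
Proof.
by move=> x; rewrite -[RHS]reprK; loc_law; case: fg => _ -> _ _ _; rewrite mulr1.
Qed.
Lemma loc_mulDl : left_distributive loc_mul loc_add.
Proof. by loc_law; rewrite mulrDl. Qed.
Lemma loc_mulDr : right_distributive loc_mul loc_add.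
Proof. by loc_law; rewrite mulrDr. Qed.

HB.instance Definition _ := GRing.Zmodule_isPzRing.Build loc
  loc_mulA loc_mul1l loc_mul1r loc_mulDl loc_mulDr.

Lemma loc_scaleA a b x : loc_scale a (loc_scale b x) = loc_scale (a * b) x.
Proof. by loc_law; rewrite scalerA. Qed.
Lemma loc_scale1 : left_id 1 loc_scale.
Proof. by move=> x; rewrite -[RHS]reprK; loc_law; rewrite scale1r. Qed.
Lemma loc_scaleDr : right_distributive loc_scale loc_add.
Proof. by loc_law; rewrite scalerDr. Qed.
Lemma loc_scaleDl x : {morph loc_scale^~ x : a b / a + b >-> loc_add a b}.
Proof. by loc_law; rewrite scalerDl. Qed.

HB.instance Definition _ := GRing.Zmodule_isLmodule.Build R loc
  loc_scaleA loc_scale1 loc_scaleDr loc_scaleDl.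

End Localization.

(******************************************************************************)
(* Finite dimensional left A-modules, in matrix form: the underlying space is *)
(* 'cV[k]_(mdim M) and a : A acts by the matrix mact M a on the left. Every   *)
(* finite dimensional left A-module is isomorphic to one of these.            *)
(******************************************************************************)

Section Modules.
Context (k : finFieldType) (A : falgType k).

Record amod := AMod {
  mdim : nat;
  mact : {lrmorphism A -> 'M[k]_mdim}
}.

Definition mod_hom (M N : amod) (f : 'M[k]_(mdim N, mdim M)) : Prop :=
  forall a, f *m mact M a = mact N a *m f.

Definition mx_inj m n (f : 'M[k]_(m, n)) : Prop :=
  forall x : 'cV_n, f *m x = 0 -> x = 0.

Definition mx_surj m n (f : 'M[k]_(m, n)) : Prop :=
  forall y : 'cV_m, exists x : 'cV_n, y = f *m x.

Definition mx_exact m n p (f : 'M[k]_(n, p)) (g : 'M[k]_(m, n)) : Prop :=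
  forall x : 'cV_n, g *m x = 0 <-> exists y : 'cV_p, x = f *m y.

Definition mod_ses (N L M : amod) (f : 'M[k]_(mdim L, mdim N))
    (g : 'M[k]_(mdim M, mdim L)) : Prop :=
  [/\ mod_hom f, mod_hom g, mx_inj f, mx_exact f g & mx_surj g].

Definition mod_iso (M N : amod) : Prop :=
  exists (f : 'M[k]_(mdim N, mdim M)) (g : 'M[k]_(mdim M, mdim N)),
    [/\ mod_hom f, mod_hom g, g *m f = 1%:M & f *m g = 1%:M].

Definition projective (P : amod) : Prop :=
  forall (M N : amod) (g : 'M[k]_(mdim N, mdim M)) (f : 'M[k]_(mdim N, mdim P)),
    mod_hom g -> mx_surj g -> mod_hom f ->
    exists h : 'M[k]_(mdim M, mdim P), mod_hom h /\ g *m h = f.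

Definition hereditary : Prop :=
  forall (M P : amod) (f : 'M[k]_(mdim P, mdim M)),
    mod_hom f -> mx_inj f -> projective P -> projective M.

Definition simple_mod (S : amod) : Prop :=
  (0 < mdim S)%N /\
  forall (M : amod) (f : 'M[k]_(mdim S, mdim M)),
    mod_hom f -> mx_inj f -> mdim M = 0%N \/ mx_surj f.

Definition simple_system n (S : 'I_n -> amod) : Prop :=
  [/\ forall i, simple_mod (S i),
      forall i j, mod_iso (S i) (S j) -> i = j
    & forall M, simple_mod M -> exists i, mod_iso M (S i)].

(* M has a composition series in which S i occurs m i times. *)
Inductive comp_mult n (S : 'I_n -> amod) : amod -> 'cV[int]_n -> Prop :=
| CompZero M : mdim M = 0%N -> comp_mult S M 0
| CompStep i N M m (f : 'M[k]_(mdim M, mdim N)) (g : 'M[k]_(mdim (S i), mdim M)) :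
    mod_ses f g -> comp_mult S N m -> comp_mult S M (m + delta_mx i 0).

Definition dimvec n (S : 'I_n -> amod) (M : amod) : 'cV[int]_n :=
  xget 0 [set m | comp_mult S M m].

Record pmod := PMod { pmod_val :> amod; pmodP : projective pmod_val }.

Definition zero_act (a : A) : 'M[k]_0 := 0.

Lemma zero_act_linear : linear zero_act.
Proof. by move=> c a b; rewrite /zero_act scaler0 addr0. Qed.

Lemma zero_act_monoid : monoid_morphism zero_act.
Proof. by split=> [|a b]; apply/matrixP => -[]. Qed.

HB.instance Definition _ := GRing.isLinear.Build k A 'M[k]_0 _ zero_act
  zero_act_linear.
HB.instance Definition _ := GRing.isMonoidMorphism.Build A 'M[k]_0 zero_act
  zero_act_monoid.

Definition zero_amod : amod := AMod zero_act.

Lemma zero_projective : projective zero_amod.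
Proof.
move=> M N g f _ _ _; exists 0; split; first by move=> a; rewrite mul0mx mulmx0.
by apply/matrixP => i [].
Qed.

Definition zero_pmod : pmod := PMod zero_projective.

End Modules.

(******************************************************************************)
(* The category C_2(P) of morphisms src -> tgt between projectives.           *)
(******************************************************************************)

Section TwoTerm.
Context (k : finFieldType) (A : falgType k).

Record c2p := C2P {
  src : pmod A;
  tgt : pmod A;
  dif : 'M[k]_(mdim tgt, mdim src);
  difP : mod_hom dif
}.

HB.instance Definition _ := gen_eqMixin c2p.
HB.instance Definition _ := gen_choiceMixin c2p.

(* Pairs of linear maps, in degrees -1 and 0; the morphisms are those         *)
(* satisfying is_mor.                                                         *)
Notation mor M N := ('M[k]_(mdim (src N), mdim (src M)) *
                     'M[k]_(mdim (tgt N), mdim (tgt M)))%type.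

Definition is_mor (M N : c2p) (h : mor M N) : Prop :=
  [/\ mod_hom h.1, mod_hom h.2 & h.2 *m dif M = dif N *m h.1].

Definition mor_comp (L M N : c2p) (h : mor M N) (g : mor L M) : mor L N :=
  (h.1 *m g.1, h.2 *m g.2).

Definition mor_id (M : c2p) : mor M M := (1%:M, 1%:M).

Definition inverse_mors (M N : c2p) (h : mor M N) (g : mor N M) : Prop :=
  [/\ is_mor h, is_mor g, mor_comp g h = mor_id M & mor_comp h g = mor_id N].

Definition c2_iso (M N : c2p) : bool :=
  `[< exists (h : mor M N) (g : mor N M), inverse_mors h g >].

Lemma is_mor_id M : is_mor (mor_id M).
Proof. by split=> [a|a|]; rewrite mul1mx mulmx1. Qed.

Lemma is_mor_comp L M N (h : mor M N) (g : mor L M) :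
  is_mor h -> is_mor g -> is_mor (mor_comp h g).
Proof.
move=> [h1 h2 hd] [g1 g2 gd]; split=> [a|a|] /=.
- by rewrite -mulmxA g1 mulmxA h1 mulmxA.
- by rewrite -mulmxA g2 mulmxA h2 mulmxA.
- by rewrite -mulmxA gd mulmxA hd mulmxA.
Qed.

Lemma mor_compA K L M N (h : mor M N) (g : mor L M) (f : mor K L) :
  mor_comp h (mor_comp g f) = mor_comp (mor_comp h g) f.
Proof. by rewrite /mor_comp /= !mulmxA. Qed.

Lemma mor_comp1l M N (h : mor M N) : mor_comp (mor_id N) h = h.
Proof. by case: h => h1 h2; rewrite /mor_comp /= !mul1mx. Qed.

Lemma mor_comp1r M N (h : mor M N) : mor_comp h (mor_id M) = h.
Proof. by case: h => h1 h2; rewrite /mor_comp /= !mulmx1. Qed.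

Lemma inverse_mors_id M : inverse_mors (mor_id M) (mor_id M).
Proof. by split; rewrite ?mor_comp1l //; apply: is_mor_id. Qed.

Lemma inverse_mors_sym M N (h : mor M N) (g : mor N M) :
  inverse_mors h g -> inverse_mors g h.
Proof. by case. Qed.

Lemma inverse_mors_comp L M N (h : mor L M) (g : mor M L) (h' : mor M N)
    (g' : mor N M) : inverse_mors h g -> inverse_mors h' g' ->
  inverse_mors (mor_comp h' h) (mor_comp g g').
Proof.
move=> [mh mg gh hg] [mh' mg' gh' hg']; split; try exact: is_mor_comp.
- by rewrite -mor_compA (mor_compA g') gh' mor_comp1l.
- by rewrite -mor_compA (mor_compA h) hg mor_comp1l.
Qed.

Lemma c2_iso_equiv : equiv_class_of c2_iso.
Proof.
split.
- by move=> M; apply/asboolP; exists (mor_id M), (mor_id M); apply: inverse_mors_id.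
- by move=> M N; apply/asboolP/asboolP => -[h [g hg]]; exists g, h;
    apply: inverse_mors_sym.
- move=> M L N /asboolP[h [g hg]] /asboolP[h' [g' hg']]; apply/asboolP.
  by exists (mor_comp h' h), (mor_comp g g'); apply: inverse_mors_comp.
Qed.

Canonical c2_iso_rel := EquivRelPack c2_iso_equiv.

Definition c2class : Type := {eq_quot c2_iso_rel}.
HB.instance Definition _ := Choice.on c2class.
HB.instance Definition _ := EqQuotient.on c2class.

Definition homset (M N : c2p) : {set mor M N} :=
  finset (fun h : mor M N => `[< is_mor h >]).

(* homset M N is closed under linear combinations, hence equal to its span. *)
Definition dim_hom (M N : c2p) : nat := \dim <<enum (homset M N)>>%VS.

(* A short exact sequence N -> emid -> M in C_2(P). *)
Record ext (M N : c2p) := Ext {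
  emid : c2p;
  einc : mor N emid;
  eprj : mor emid M;
  einc_mor : is_mor einc;
  eprj_mor : is_mor eprj;
  ext_ses1 : mod_ses einc.1 eprj.1;
  ext_ses2 : mod_ses einc.2 eprj.2
}.

Section Ext1.
Context (M N : c2p).

HB.instance Definition _ := gen_eqMixin (ext M N).
HB.instance Definition _ := gen_choiceMixin (ext M N).

Definition ext_eqv (E E' : ext M N) : bool :=
  `[< exists (h : mor (emid E) (emid E')) (g : mor (emid E') (emid E)),
        [/\ inverse_mors h g, mor_comp h (einc E) = einc E'
          & mor_comp (eprj E') h = eprj E] >].

Lemma ext_eqv_equiv : equiv_class_of ext_eqv.
Proof.
split.
- move=> E; apply/asboolP; exists (mor_id _), (mor_id _).
  by rewrite mor_comp1l mor_comp1r; split=> //; apply: inverse_mors_id.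
- have sym E E' : ext_eqv E E' -> ext_eqv E' E.
    move=> /asboolP[h [g [hg hi hp]]]; apply/asboolP; exists g, h.
    case: (hg) => _ _ gh hg1.
    by rewrite -hi -hp mor_compA gh mor_comp1l -mor_compA hg1 mor_comp1r;
      split=> //; apply: inverse_mors_sym.
  by move=> E E'; apply/idP/idP; apply: sym.
- move=> E' E E'' /asboolP[h [g [hg hi hp]]] /asboolP[h' [g' [hg' hi' hp']]].
  apply/asboolP; exists (mor_comp h' h), (mor_comp g g').
  rewrite -mor_compA hi hi' mor_compA hp' hp; split=> //.
  exact: inverse_mors_comp.
Qed.

Canonical ext_eqv_rel := EquivRelPack ext_eqv_equiv.

Definition Ext1 : Type := {eq_quot ext_eqv_rel}.
HB.instance Definition _ := Choice.on Ext1.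
HB.instance Definition _ := EqQuotient.on Ext1.

(* The number of extension classes with middle term in the class L. These     *)
(* sets are finite: dimensions of middle terms add up and k is finite.        *)
Definition ext_card (L : c2class) : nat :=
  #|` fset_set [set e : Ext1 | \pi_c2class (emid (repr e)) = L] |.

(* (a1, a2) identifies its source with {(x1, x2) | p1 x1 = p2 x2}. *)
Definition is_pullback m n1 n2 w (p1 : 'M[k]_(m, n1)) (p2 : 'M[k]_(m, n2))
    (a1 : 'M[k]_(n1, w)) (a2 : 'M[k]_(n2, w)) : Prop :=
  p1 *m a1 = p2 *m a2 /\
  forall (x1 : 'cV_n1) (x2 : 'cV_n2), p1 *m x1 = p2 *m x2 ->
    exists! z : 'cV_w, a1 *m z = x1 /\ a2 *m z = x2.

(* On the pullback, b sends the element (i1 y1, i2 y2) to i (y1 + y2). *)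
Definition folds m n1 n2 n w (i1 : 'M[k]_(n1, m)) (i2 : 'M[k]_(n2, m))
    (i : 'M[k]_(n, m)) (a1 : 'M[k]_(n1, w)) (a2 : 'M[k]_(n2, w))
    (b : 'M[k]_(n, w)) : Prop :=
  forall (z : 'cV_w) (y1 y2 : 'cV_m),
    a1 *m z = i1 *m y1 -> a2 *m z = i2 *m y2 -> b *m z = i *m (y1 + y2).

(* E represents the Baer sum of E1 and E2: b exhibits its middle term as the  *)
(* quotient of the pullback W of E1 and E2 over M by the antidiagonal of N.   *)
Definition baer_sum (E1 E2 E : ext M N) : Prop :=
  exists (W : c2p) (a1 : mor W (emid E1)) (a2 : mor W (emid E2))
         (b : mor W (emid E)),
    [/\ [/\ is_mor a1, is_mor a2 & is_mor b],
        is_pullback (eprj E1).1 (eprj E2).1 a1.1 a2.1 /\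
        is_pullback (eprj E1).2 (eprj E2).2 a1.2 a2.2,
        mor_comp (eprj E) b = mor_comp (eprj E1) a1
      & folds (einc E1).1 (einc E2).1 (einc E).1 a1.1 a2.1 b.1 /\
        folds (einc E1).2 (einc E2).2 (einc E).2 a1.2 a2.2 b.2].

(* E' represents c . E, the pushout of E along c : N -> N. *)
Definition baer_scale (c : k) (E E' : ext M N) : Prop :=
  exists h : mor (emid E) (emid E'),
    [/\ is_mor h, mor_comp h (einc E) = c *: einc E'
      & mor_comp (eprj E') h = eprj E].

(* Ext^1 with the Baer structure is a k-vector space of dimension d. *)
Definition has_dim_ext (d : nat) : Prop :=
  exists phi : 'rV[k]_d -> Ext1,
    [/\ bijective phi,
        forall x y, baer_sum (repr (phi x)) (repr (phi y)) (repr (phi (x + y)))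
      & forall c x, baer_scale c (repr (phi x)) (repr (phi (c *: x)))].

Definition dim_ext : nat := xget 0%N [set d | has_dim_ext d].

Definition euler : int := (dim_hom M N)%:Z - (dim_ext)%:Z.

End Ext1.

(* The free module on isomorphism classes, and the twisted product, first on  *)
(* objects and then extended bilinearly. The sum over isomorphism classes has *)
(* finite support.                                                            *)
Definition Htw : Type := {malg (Zv k)[c2class]}.
HB.instance Definition _ := GRing.Lmodule.on Htw.

Definition Hcl (M : c2p) : Htw := << \pi_c2class M >>.

Definition Hmul_obj (M N : c2p) : Htw :=
  (#|k|%:R : Zv k) ^ (euler M N) *:
    \sum_(L \in [set: c2class])
      ((ext_card M N L)%:R / #|homset M N|%:R : Zv k) *: (<< L >> : Htw).

Definition Hmul (x y : Htw) : Htw :=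
  \sum_(M <- msupp x) \sum_(N <- msupp y)
    (x@_M * y@_N) *: Hmul_obj (repr M) (repr N).

Lemma Kc_hom (P : pmod A) : @mod_hom k A P P 1%:M.
Proof. by move=> a; rewrite mul1mx mulmx1. Qed.

Definition Kc (P : pmod A) : c2p := C2P (Kc_hom P).

Lemma Zc_hom (P : pmod A) : @mod_hom k A P (zero_pmod A) 0.
Proof. by move=> a; rewrite mul0mx mulmx0. Qed.

Definition Zc (P : pmod A) : c2p := C2P (Zc_hom P).

Definition Hone : Htw := Hcl (Kc (zero_pmod A)).

Definition MH : Type := loc Hmul Hone (fun P : pmod A => Hcl (Kc P)).
HB.instance Definition _ := GRing.PzRing.on MH.
HB.instance Definition _ := GRing.Lmodule.on MH.

Definition MHcl (M : c2p) : MH := loc_gen Hmul Hone _ (Hcl M).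

(* The inverse of MHcl (Kc P). *)
Definition Kinv (P : pmod A) : MH := loc_inv Hmul Hone _ P.

(* C is the minimal projective resolution of M, with augmentation e: the      *)
(* epimorphism e is essential, i.e. a projective cover.                       *)
Definition min_resolution (M : amod A) (C : c2p)
    (e : 'M[k]_(mdim M, mdim (tgt C))) : Prop :=
  mod_ses (dif C) e /\
  forall (N : amod A) (h : 'M[k]_(mdim (tgt C), mdim N)),
    mod_hom h -> mx_surj (e *m h) -> mx_surj h.

Definition Cc (M : amod A) : c2p :=
  xget (Kc (zero_pmod A)) [set C | exists e, @min_resolution M C e].

Section Dimension.
Context (n : nat) (S : 'I_n -> amod A).

Definition dim_tilde (a : 'cV[int]_n) : 'cV[int]_(n + n) := col_mx 0 a.
Definition dim_bar (a : 'cV[int]_n) : 'cV[int]_(n + n) := col_mx a 0.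

Definition dimc (M : c2p) : 'cV[int]_(n + n) :=
  col_mx (dimvec S (tgt M) - dimvec S (src M)) (dimvec S (tgt M)).

Definition Kelt (a : 'cV[int]_n) : MH :=
  xget 0 [set x : MH | exists P Q : pmod A,
                         a = dimvec S P - dimvec S Q /\ x = MHcl (Kc P) * Kinv Q].

Definition Xmod (M : amod A) : MH :=
  Kelt (- dimvec S (tgt (Cc M))) * MHcl (Cc M).

Definition Xshift (P : pmod A) : MH := MHcl (Zc P).

Definition Xobj (M : amod A) (P : pmod A) : MH := Xmod M * Xshift P.

Definition torus : Type := galg (Zv k) 'cV[int]_(n + n).
HB.instance Definition _ := GRing.ComAlgebra.on torus.

End Dimension.

End TwoTerm.

(* Main.v *)
From HB Require Import structures.
Require Import Defs.
From mathcomp Require Import all_boot all_order all_algebra all_field.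
From mathcomp Require Import boolp classical_sets cardinality fsbigop.
From mathcomp Require Import finmap monalg.

(** The integration map is the lift to the localization of the linear map
    that sends [M] to X^(dim M). Everything reduces to one identity for two
    complexes M and N: the dimension vector is additive on extensions, so all
    middle terms of extensions of M by N contribute the same monomial, and the
    product [M] * [N] is sent to that monomial with coefficient
      q^(dim Hom(M, N) - dim Ext^1(M, N)) * |Ext^1(M, N)| / |Hom(M, N)| = 1
    ([integ_Hmul_obj]).

    Two facts are needed for this coefficient. First, Ext^1(M, N) has to be a
    finite dimensional vector space for the Baer structure
    ([has_dim_ext_exists]). The terms of M are projective, so an extension
    splits in each degree and is given by a cocycle M_{-1} -> N_0, the corner
    of a block triangular differential. Changing the splitting changes the
    cocycle by d_N u - w d_M, so that Ext^1(M, N) is the quotient of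
    Hom_A(M_{-1}, N_0) by these coboundaries; a complement of the coboundaries
    parametrizes it linearly. Second, q is invertible in Z[v, v^-1].

    Additivity of dimension vectors ([dimvec_ses]) is obtained from projective
    covers instead of the Jordan-Hoelder theorem. If P_i is the projective
    cover of the simple module S_i, then Hom(P_i, S_j) vanishes for j <> i,
    while Hom(P_i, -) is exact; so dim Hom(P_i, M) is dim Hom(P_i, S_i) times
    the multiplicity of S_i in any composition series of M. This determines
    the multiplicities and makes them additive. Projective covers, and with
    them minimal resolutions, exist because A is hereditary: a projective of
    least dimension mapping onto M is a cover of M, as the image of any map
    into it is again projective ([projective_cover]).

    The elements K_alpha are defined for all alpha because the resolutions of
    the simple modules express each basis vector as a difference of classes of
    projectives ([projective_classes_generate]). The values on K_alpha * [M]
    and on X_(M + P[1]) then follow by computing exponents, using additivity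
    along the minimal resolution of M. *)

Set Implicit Arguments.
Unset Strict Implicit.
Unset Printing Implicit Defensive.

Import GRing.Theory Num.Theory.
Local Open Scope ring_scope.
Local Open Scope quotient_scope.

(** * Exactness for matrices acting on column vectors *)

Section MatrixExactness.
Context (k : finFieldType).

Lemma mulmx_cV_ext m n (f g : 'M[k]_(m, n)) :
  (forall x : 'cV_n, f *m x = g *m x) -> f = g.
Proof.
move=> fg; apply/matrixP => i j.
by have := congr1 (fun u : 'cV_m => u i 0) (fg (delta_mx j 0)); rewrite -!colE !mxE.
Qed.

Lemma mx_injI m n p (f : 'M[k]_(m, n)) (x y : 'M[k]_(n, p)) :
  mx_inj f -> f *m x = f *m y -> x = y.
Proof.
move=> injf fxy; apply: mulmx_cV_ext => u; apply/eqP; rewrite -subr_eq0; apply/eqP.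
by apply: injf; rewrite mulmxBr !mulmxA fxy subrr.
Qed.

Lemma mx_surjI m n p (f : 'M[k]_(m, n)) (x y : 'M[k]_(p, m)) :
  mx_surj f -> x *m f = y *m f -> x = y.
Proof.
move=> surjf xyf; apply: mulmx_cV_ext => u.
by have [v ->] := surjf u; rewrite !mulmxA xyf.
Qed.

Lemma mx_surj_lift m n p (f : 'M[k]_(m, n)) (y : 'M[k]_(m, p)) :
  (forall j, exists x : 'cV_n, col j y = f *m x) -> exists x, y = f *m x.
Proof.
move=> yf; have [x xP] := choice yf.
exists (\matrix_(i, j) x j i 0); apply/matrixP => i j.
have := congr1 (fun u : 'cV_m => u i 0) (xP j); rewrite !mxE => ->.
by apply: eq_bigr => l _; rewrite !mxE.
Qed.

(** The universal property of the kernel, for matrices of any width. *)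
Lemma mx_exact_factor m n p r (i : 'M[k]_(n, p)) (c : 'M[k]_(m, n))
    (f : 'M[k]_(n, r)) :
  mx_exact i c -> c *m f = 0 -> exists g, f = i *m g.
Proof.
move=> ic cf; apply: mx_surj_lift => j; apply/ic.
by rewrite colE mulmxA cf mul0mx.
Qed.

Lemma mx_exact0 m n p (i : 'M[k]_(n, p)) (c : 'M[k]_(m, n)) :
  mx_exact i c -> c *m i = 0.
Proof.
move=> ic; apply: mulmx_cV_ext => x; rewrite mul0mx -mulmxA.
by apply/ic; exists x.
Qed.

Lemma mx_injP m n (f : 'M[k]_(m, n)) : mx_inj f <-> exists g, g *m f = 1%:M.
Proof.
split=> [injf|[g gf] x fx]; last by rewrite -[x]mul1mx -gf -mulmxA fx mulmx0.
have: row_free f^T.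
  rewrite -kermx_eq0; apply/eqP/row_matrixP => i; rewrite row0.
  apply: trmx_inj; rewrite trmx0; apply: injf.
  by rewrite -[X in X *m _]trmxK -trmx_mul -row_mul mulmx_ker row0 trmx0.
by case/row_freeP => g fg; exists g^T; rewrite -[f]trmxK -trmx_mul fg trmx1.
Qed.

Lemma mx_surjP m n (f : 'M[k]_(m, n)) : mx_surj f <-> exists g, f *m g = 1%:M.
Proof.
split=> [surjf|[g fg] y]; last by exists (g *m y); rewrite mulmxA fg mul1mx.
have [g ->] : exists g, 1%:M = f *m g by apply: mx_surj_lift => j; apply: surjf.
by exists g.
Qed.

Lemma mx_inj_dim m n (f : 'M[k]_(m, n)) : mx_inj f -> (n <= m)%N.
Proof.
by case/mx_injP => g gf; rewrite -(mxrank1 k n) -gf (leq_trans (mxrankM_maxr _ _)) ?rank_leq_row.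
Qed.

Lemma mx_surj_dim m n (f : 'M[k]_(m, n)) : mx_surj f -> (m <= n)%N.
Proof.
by case/mx_surjP => g fg; rewrite -(mxrank1 k m) -fg (leq_trans (mxrankM_maxl _ _)) ?rank_leq_col.
Qed.

Lemma mx_inj_surj m n (f : 'M[k]_(m, n)) : mx_inj f -> (m <= n)%N -> mx_surj f.
Proof.
move=> injf lemn; have := mx_inj_dim injf => lenm.
have emn : m = n by apply/eqP; rewrite eqn_leq lemn.
move: f injf {lemn lenm}; rewrite emn => f /mx_injP[g gf]; apply/mx_surjP; exists g.
exact: mulmx1C.
Qed.

Lemma mx_surj_inj m n (f : 'M[k]_(m, n)) : mx_surj f -> (n <= m)%N -> mx_inj f.
Proof.
move=> surjf lenm; have := mx_surj_dim surjf => lemn.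
have emn : m = n by apply/eqP; rewrite eqn_leq lemn.
move: f surjf {lemn lenm}; rewrite emn => f /mx_surjP[g fg]; apply/mx_injP; exists g.
exact: mulmx1C.
Qed.

Lemma mx_surj_mul m n p (f : 'M[k]_(m, n)) (g : 'M[k]_(n, p)) :
  mx_surj f -> mx_surj g -> mx_surj (f *m g).
Proof.
move=> sf sg y; have [u ->] := sf y; have [v ->] := sg u.
by exists v; rewrite mulmxA.
Qed.

Lemma mx_surj_mull m n p (f : 'M[k]_(m, n)) (g : 'M[k]_(n, p)) :
  mx_surj (f *m g) -> mx_surj f.
Proof. by move=> sfg y; have [x ->] := sfg y; exists (g *m x); rewrite mulmxA. Qed.

Lemma mx_surj0_dim m n : mx_surj (0 : 'M[k]_(m, n)) -> m = 0%N.
Proof.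
by case/mx_surjP => g; rewrite mul0mx => e; rewrite -(mxrank1 k m) -e mxrank0.
Qed.

Lemma mx_inj0_dim m n : mx_inj (0 : 'M[k]_(m, n)) -> n = 0%N.
Proof.
by case/mx_injP => g; rewrite mulmx0 => e; rewrite -(mxrank1 k n) -e mxrank0.
Qed.

Lemma mx_kernel m n (g : 'M[k]_(m, n)) :
  exists r (f : 'M[k]_(n, r)), mx_inj f /\ mx_exact f g.
Proof.
exists (\rank (kermx g^T)), (row_base (kermx g^T))^T; split.
  apply/mx_injP; have /row_freeP[h fh] := row_base_free (kermx g^T).
  by exists h^T; rewrite -trmx_mul fh trmx1.
move=> x; split=> [gx|[y ->]].
  have: (x^T <= row_base (kermx g^T))%MS.
    by rewrite eq_row_base; apply/sub_kermxP; rewrite -trmx_mul gx trmx0.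
  by case/submxP => D xD; exists D^T; rewrite -trmx_mul -xD trmxK.
have: ((row_base (kermx g^T)) <= kermx g^T)%MS by rewrite eq_row_base.
by move/sub_kermxP => bg; rewrite mulmxA -[X in X *m _ *m _]trmxK -trmx_mul bg trmx0 mul0mx.
Qed.

(** The square matrix [cokermx] has dependent columns; passing to a column basis
    makes the map onto. *)
Lemma mx_cokernel m n (f : 'M[k]_(m, n)) :
  exists r (g : 'M[k]_(r, m)), mx_surj g /\ mx_exact f g.
Proof.
set C := cokermx f^T.
exists (\rank C), (col_base C)^T; split.
  apply/mx_surjP; have /row_fullP[h hf] := col_base_full C.
  by exists h^T; rewrite -trmx_mul hf trmx1.
have injC (x : 'cV_m) : (col_base C)^T *m x = 0 <-> (x^T <= f^T)%MS.
  have -> : ((x^T <= f^T)%MS : Prop) = (x^T *m C = 0).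
    by rewrite submxE; apply/propext; split=> [/eqP|->].
  rewrite -[X in x^T *m X](mulmx_base C); split=> [cx|].
    by rewrite mulmxA -[col_base C]trmxK -trmx_mul cx trmx0 mul0mx.
  have /row_freeP[h bh] := row_base_free C.
  rewrite mulmxA => /(congr1 (fun u => u *m h)); rewrite -mulmxA bh mulmx1 mul0mx.
  by move=> xc; rewrite -[x]trmxK -trmx_mul xc trmx0.
move=> x; split=> [/injC/submxP[D xD]|[y ->]].
  by exists D^T; rewrite -[f]trmxK -trmx_mul -xD trmxK.
by apply/injC; rewrite trmx_mul submxMl.
Qed.

End MatrixExactness.

Section BiproductMatrices.
Context (k : finFieldType).

Definition inl_mx m n : 'M[k]_(m + n, m) := col_mx 1%:M 0.
Definition inr_mx m n : 'M[k]_(m + n, n) := col_mx 0 1%:M.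
Definition prl_mx m n : 'M[k]_(m, m + n) := row_mx 1%:M 0.
Definition prr_mx m n : 'M[k]_(n, m + n) := row_mx 0 1%:M.

Lemma prl_inl m n : prl_mx m n *m inl_mx m n = 1%:M.
Proof. by rewrite mul_row_col mulmx1 mulmx0 addr0. Qed.
Lemma prl_inr m n : prl_mx m n *m inr_mx m n = 0.
Proof. by rewrite mul_row_col mulmx0 mul0mx addr0. Qed.
Lemma prr_inl m n : prr_mx m n *m inl_mx m n = 0.
Proof. by rewrite mul_row_col mulmx0 mul0mx addr0. Qed.
Lemma prr_inr m n : prr_mx m n *m inr_mx m n = 1%:M.
Proof. by rewrite mul_row_col mulmx1 mulmx0 add0r. Qed.
Lemma inl_inr_sum m n : inl_mx m n *m prl_mx m n + inr_mx m n *m prr_mx m n = 1%:M.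
Proof.
rewrite !mul_col_row add_block_mx !mulmx1 !mulmx0 ?mul0mx !addr0 !add0r.
by rewrite -scalar_mx_block.
Qed.

Lemma mul_row_inl m n p (a : 'M[k]_(p, m)) (b : 'M_(p, n)) : row_mx a b *m inl_mx m n = a.
Proof. by rewrite mul_row_col mulmx1 mulmx0 addr0. Qed.
Lemma mul_row_inr m n p (a : 'M[k]_(p, m)) (b : 'M_(p, n)) : row_mx a b *m inr_mx m n = b.
Proof. by rewrite mul_row_col mulmx1 mulmx0 add0r. Qed.
Lemma row_inl_inr m n : row_mx (inl_mx m n) (inr_mx m n) = 1%:M.
Proof. by rewrite -block_mxEh -scalar_mx_block. Qed.

(** A map out of a biproduct is determined on the two summands. *)
Lemma row_mx_ext m n p (f g : 'M[k]_(p, m + n)) :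
  f *m inl_mx m n = g *m inl_mx m n -> f *m inr_mx m n = g *m inr_mx m n -> f = g.
Proof.
by rewrite -[f]hsubmxK -[g]hsubmxK !mul_row_inl !mul_row_inr => -> ->.
Qed.

End BiproductMatrices.
Arguments inl_mx {k m n}.
Arguments inr_mx {k m n}.
Arguments prl_mx {k m n}.
Arguments prr_mx {k m n}.

(** * Submodules, quotients, direct sums and free modules *)

Section ModuleConstructions.
Context (k : finFieldType) (A : falgType k).
Implicit Types M N L P : amod A.

Lemma mod_hom_id M : mod_hom (M := M) (N := M) 1%:M.
Proof. by move=> a; rewrite mul1mx mulmx1. Qed.

Lemma mod_hom0 M N : mod_hom (M := M) (N := N) 0.
Proof. by move=> a; rewrite mul0mx mulmx0. Qed.

Lemma mod_homM L M N (f : 'M_(mdim N, mdim M)) (g : 'M_(mdim M, mdim L)) :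
  mod_hom f -> mod_hom g -> @mod_hom _ _ L N (f *m g).
Proof. by move=> hf hg a; rewrite -mulmxA hg mulmxA hf mulmxA. Qed.

Lemma mod_homD M N (f g : 'M_(mdim N, mdim M)) :
  mod_hom f -> mod_hom g -> mod_hom (f + g).
Proof. by move=> hf hg a; rewrite mulmxDl mulmxDr hf hg. Qed.

Lemma mod_homZ M N c (f : 'M_(mdim N, mdim M)) : mod_hom f -> mod_hom (c *: f).
Proof. by move=> hf a; rewrite -scalemxAl -scalemxAr hf. Qed.

Lemma mod_homN M N (f : 'M_(mdim N, mdim M)) : mod_hom f -> mod_hom (- f).
Proof. by move=> hf; rewrite -scaleN1r; apply: mod_homZ. Qed.

Lemma mod_homB M N (f g : 'M_(mdim N, mdim M)) :
  mod_hom f -> mod_hom g -> mod_hom (f - g).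
Proof. by move=> hf hg; apply: mod_homD => //; apply: mod_homN. Qed.

Lemma mod_hom_mono L M N (f : 'M_(mdim N, mdim M)) (g : 'M_(mdim M, mdim L)) :
  mod_hom f -> mx_inj f -> mod_hom (f *m g) -> mod_hom g.
Proof.
by move=> hf injf hfg a; apply: (mx_injI injf); rewrite mulmxA hfg [RHS]mulmxA hf mulmxA.
Qed.

Lemma mod_hom_epi L M N (f : 'M_(mdim N, mdim M)) (g : 'M_(mdim M, mdim L)) :
  mod_hom g -> mx_surj g -> mod_hom (f *m g) -> mod_hom f.
Proof.
by move=> hg sg hfg a; apply: (mx_surjI sg); rewrite -mulmxA -hg mulmxA hfg mulmxA.
Qed.

Section MakeModule.
Context (n : nat) (act : A -> 'M[k]_n) (actL : linear act) (act1 : act 1 = 1%:M).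
Context (actM : forall a b, act (a * b) = act a *m act b).

Definition mk_act (a : A) : 'M[k]_n := act a.

Lemma mk_act_linear : linear mk_act. Proof. exact: actL. Qed.
Lemma mk_act_monoid : monoid_morphism mk_act. Proof. by []. Qed.

HB.instance Definition _ :=
  GRing.isLinear.Build k A 'M[k]_n _ mk_act mk_act_linear.
HB.instance Definition _ :=
  GRing.isMonoidMorphism.Build A 'M[k]_n mk_act mk_act_monoid.

Definition mkmod : amod A := AMod mk_act.
End MakeModule.

Section SubQuotient.
Context (M : amod A) (r : nat).

(** If f and g split a submodule or a quotient off the space of M, the action
    of A on the summand is the compression g a f of its action on M. The
    condition [compat] holds as soon as one of the image of f and the kernel of
    g is stable under A. *)
Section Compress.
Context (f : 'M[k]_(mdim M, r)) (g : 'M[k]_(r, mdim M)) (gf : g *m f = 1%:M).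
Context (compat : forall a b, g *m mact M a *m mact M b *m f =
                              (g *m mact M a *m f) *m (g *m mact M b *m f)).

Lemma compress_linear : linear (fun a => g *m mact M a *m f).
Proof. by move=> c a b; rewrite linearP mulmxDr mulmxDl -scalemxAr -scalemxAl. Qed.
Lemma compress1 : g *m mact M 1 *m f = 1%:M.
Proof. by rewrite rmorph1 mulmx1. Qed.
Lemma compressM a b :
  g *m mact M (a * b) *m f = (g *m mact M a *m f) *m (g *m mact M b *m f).
Proof. by rewrite -compat rmorphM /= !mulmxA. Qed.
Definition compress : amod A := mkmod compress_linear compress1 compressM.
End Compress.
End SubQuotient.

Lemma submodule_exists M r (f : 'M[k]_(mdim M, r)) :
  mx_inj f -> (forall a, exists x, mact M a *m f = f *m x) ->
  exists K : amod A, exists f' : 'M[k]_(mdim M, mdim K),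
    [/\ mod_hom f', mx_inj f' &
      forall x : 'cV_(mdim M), (exists y, x = f' *m y) <-> exists y, x = f *m y].
Proof.
move=> injf stab; have [g gf] := proj1 (mx_injP f) injf.
have fgs a : f *m (g *m mact M a *m f) = mact M a *m f.
  by have [x xP] := stab a; rewrite -mulmxA xP (mulmxA g) gf mul1mx.
have compat a b : g *m mact M a *m mact M b *m f =
                  (g *m mact M a *m f) *m (g *m mact M b *m f).
  by rewrite -mulmxA -fgs !mulmxA.
by exists (compress gf compat), f; split=> // a; rewrite fgs.
Qed.

Lemma quotient_exists M r (g : 'M[k]_(r, mdim M)) :
  mx_surj g -> (forall a, exists x, g *m mact M a = x *m g) ->
  exists K : amod A, exists g' : 'M[k]_(mdim K, mdim M),
    [/\ mod_hom g', mx_surj g' &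
      forall x : 'cV_(mdim M), g' *m x = 0 <-> g *m x = 0].
Proof.
move=> surjg stab; have [f gf] := proj1 (mx_surjP g) surjg.
have gfs a : (g *m mact M a *m f) *m g = g *m mact M a.
  by have [x xP] := stab a; rewrite xP -(mulmxA x) gf mulmx1.
have compat a b : g *m mact M a *m mact M b *m f =
                  (g *m mact M a *m f) *m (g *m mact M b *m f).
  by rewrite -[in LHS]gfs !mulmxA.
by exists (compress gf compat), g; split=> // a; rewrite -gfs.
Qed.

Lemma kernel_exists M N (g : 'M[k]_(mdim N, mdim M)) : mod_hom g ->
  exists K : amod A, exists f : 'M[k]_(mdim M, mdim K),
    [/\ mod_hom f, mx_inj f & mx_exact f g].
Proof.
move=> hg; have [r [f [injf fg]]] := mx_kernel g.
have stab a : exists x, mact M a *m f = f *m x.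
  by apply: (mx_exact_factor fg); rewrite mulmxA hg -mulmxA (mx_exact0 fg) mulmx0.
have [K [f' [hf' injf' ff']]] := submodule_exists injf stab.
exists K, f'; split=> // x.
by split=> [gx|xf]; [apply/ff'/fg|apply/fg/ff'].
Qed.

Lemma cokernel_exists M N (f : 'M[k]_(mdim N, mdim M)) : mod_hom f ->
  exists Q : amod A, exists g : 'M[k]_(mdim Q, mdim N),
    [/\ mod_hom g, mx_surj g & mx_exact f g].
Proof.
move=> hf; have [r [g [surjg fg]]] := mx_cokernel f.
have [s gs] := proj1 (mx_surjP g) surjg.
have stab a : exists x, g *m mact N a = x *m g.
  exists (g *m mact N a *m s); apply/eqP; rewrite -subr_eq0; apply/eqP.
  have [y yP] : exists y, 1%:M - s *m g = f *m y.
    by apply: (mx_exact_factor fg); rewrite mulmxBr mulmx1 mulmxA gs mul1mx subrr.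
  have -> : g *m mact N a - g *m mact N a *m s *m g = g *m mact N a *m (1%:M - s *m g).
    by rewrite mulmxBr mulmx1 !mulmxA.
  by rewrite yP -mulmxA (mulmxA _ f) -hf !mulmxA (mx_exact0 fg) !mul0mx.
have [Q [g' [hg' sg' gg']]] := quotient_exists surjg stab.
exists Q, g'; split=> // x.
by split=> [gx|xf]; [apply/fg/gg'|apply/gg'/fg].
Qed.

(** The image is the kernel of the cokernel. *)
Lemma image_exists M N (f : 'M[k]_(mdim N, mdim M)) : mod_hom f ->
  exists I : amod A, exists (i : 'M[k]_(mdim N, mdim I)) (p : 'M[k]_(mdim I, mdim M)),
    [/\ mod_hom i, mod_hom p, mx_inj i, mx_surj p & f = i *m p].
Proof.
move=> hf; have [Q [c [hc sc fc]]] := cokernel_exists hf.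
have [I [i [hi ii ic]]] := kernel_exists hc.
have [p fp] := mx_exact_factor ic (mx_exact0 fc).
exists I, i, p; split=> //; first by apply: (mod_hom_mono hi ii); rewrite -fp.
move=> y; have /fc[x xP] : c *m (i *m y) = 0 by apply/ic; exists y.
by exists x; apply: (mx_injI ii); rewrite xP fp mulmxA.
Qed.

Section DirectSum.
Context (M N : amod A).
Let act a := block_mx (mact M a) 0 0 (mact N a).
Lemma dsum_linear : linear act.
Proof.
by move=> c a b; rewrite /act !linearP scale_block_mx add_block_mx !scaler0 !addr0.
Qed.
Lemma dsum1 : act 1 = 1%:M.
Proof. by rewrite [RHS]scalar_mx_block /act !rmorph1. Qed.
Lemma dsumM a b : act (a * b) = act a *m act b.
Proof. by rewrite /act !rmorphM mulmx_block !mulmx0 !mul0mx !addr0 add0r. Qed.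
Definition dsum : amod A := mkmod dsum_linear dsum1 dsumM.
End DirectSum.

Lemma mod_hom_row M N L (f : 'M_(mdim L, mdim M)) (g : 'M_(mdim L, mdim N)) :
  mod_hom f -> mod_hom g -> @mod_hom _ _ (dsum M N) L (row_mx f g).
Proof.
by move=> hf hg a; rewrite [LHS]mul_row_block mul_mx_row !mulmx0 addr0 add0r hf hg.
Qed.

Lemma mod_hom_col M N L (f : 'M_(mdim M, mdim L)) (g : 'M_(mdim N, mdim L)) :
  mod_hom f -> mod_hom g -> @mod_hom _ _ L (dsum M N) (col_mx f g).
Proof.
by move=> hf hg a; rewrite [RHS]mul_block_col mul_col_mx !mul0mx addr0 add0r hf hg.
Qed.

Lemma mod_hom_inl M N : @mod_hom _ _ M (dsum M N) inl_mx.
Proof. exact: mod_hom_col (mod_hom_id _) (mod_hom0 _ _). Qed.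
Lemma mod_hom_inr M N : @mod_hom _ _ N (dsum M N) inr_mx.
Proof. exact: mod_hom_col (mod_hom0 _ _) (mod_hom_id _). Qed.
Lemma mod_hom_prl M N : @mod_hom _ _ (dsum M N) M prl_mx.
Proof. exact: mod_hom_row (mod_hom_id _) (mod_hom0 _ _). Qed.
Lemma mod_hom_prr M N : @mod_hom _ _ (dsum M N) N prr_mx.
Proof. exact: mod_hom_row (mod_hom0 _ _) (mod_hom_id _). Qed.

Lemma dsum_ses M N : @mod_ses _ _ M (dsum M N) N inl_mx prr_mx.
Proof.
split; [exact: mod_hom_inl|exact: mod_hom_prr|..].
- by apply/mx_injP; exists prl_mx; apply: prl_inl.
- move=> x; split=> [xr|[y ->]]; last by rewrite mulmxA prr_inl mul0mx.
  exists (prl_mx *m x); rewrite mulmxA -[LHS]mul1mx -inl_inr_sum mulmxDl.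
  by rewrite -(mulmxA inr_mx) xr mulmx0 addr0.
- by apply/mx_surjP; exists inr_mx; apply: prr_inr.
Qed.

(** Lift on each of the two summands. *)
Lemma dsum_projective M N : projective M -> projective N -> projective (dsum M N).
Proof.
move=> pM pN X Y g f hg sg hf.
have [h1 [hh1 e1]] := pM _ _ g _ hg sg (mod_homM hf (mod_hom_inl M N)).
have [h2 [hh2 e2]] := pN _ _ g _ hg sg (mod_homM hf (mod_hom_inr M N)).
exists (row_mx h1 h2); split; first exact: mod_hom_row.
by rewrite mul_mx_row e1 e2 -(mul_mx_row f) row_inl_inr mulmx1.
Qed.

Import VectorInternalTheory.
Section Regular.
Let act (a : A) : 'M[k]_(dim A) := (lin1_mx (fun u => v2r (a * r2v u)))^T.
(** Elements of A are coordinate row vectors, while modules consist of column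
    vectors; hence the transpositions. *)
Lemma reg_actE a (x : 'cV_(dim A)) : act a *m x = (v2r (a * r2v x^T))^T.
Proof.
have linf : linear (fun u : 'rV[k]_(dim A) => v2r (a * r2v u)).
  by move=> c u v; rewrite linearP mulrDr -scalerAr linearP.
pose F := GRing.isLinear.Build _ _ _ _ _ linf.
pose f : {linear _ -> _} := HB.pack (fun u : 'rV[k]_(dim A) => v2r (a * r2v u)) F.
rewrite /act -[x in LHS]trmxK -trmx_mul; congr (_^T); exact: (mul_rV_lin1 f).
Qed.
Lemma reg_linear : linear act.
Proof.
move=> c a b; apply: mulmx_cV_ext => x.
rewrite mulmxDl -scalemxAl !reg_actE -linearP /= mulrDl -scalerAl.
by rewrite !linearD /= !linearZ.
Qed.
Lemma reg1 : act 1 = 1%:M.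
Proof. by apply: mulmx_cV_ext => x; rewrite reg_actE mul1r r2vK trmxK mul1mx. Qed.
Lemma regM a b : act (a * b) = act a *m act b.
Proof.
by apply: mulmx_cV_ext => x; rewrite -mulmxA !reg_actE trmxK v2rK mulrA.
Qed.
Definition regmod : amod A := mkmod reg_linear reg1 regM.

(** The homomorphism a |-> a x from the free module of rank one. *)
Section Orbit.
Context (M : amod A) (x : 'cV[k]_(mdim M)).
Definition orbmx : 'M[k]_(mdim M, dim A) :=
  (lin1_mx (fun u : 'rV_(dim A) => (mact M (r2v u) *m x)^T))^T.
Lemma orbmxE (y : 'cV_(dim A)) : orbmx *m y = mact M (r2v y^T) *m x.
Proof.
have linf : linear (fun u : 'rV_(dim A) => (mact M (r2v u) *m x)^T).
  by move=> c u v; rewrite !linearP /= mulmxDl -scalemxAl linearD linearZ.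
pose F := GRing.isLinear.Build _ _ _ _ _ linf.
pose f : {linear _ -> _} := HB.pack (fun u : 'rV_(dim A) => (mact M (r2v u) *m x)^T) F.
rewrite /orbmx -[y in LHS]trmxK -trmx_mul -[RHS]trmxK; congr (_^T).
exact: (mul_rV_lin1 f).
Qed.
Lemma orb_hom : @mod_hom _ _ regmod M orbmx.
Proof.
move=> a; apply: mulmx_cV_ext => y; rewrite -!mulmxA orbmxE [_ *m y]reg_actE.
by rewrite trmxK v2rK rmorphM /= -mulmxA orbmxE.
Qed.
Lemma orb_mem : exists y, x = orbmx *m y.
Proof. by exists (v2r 1)^T; rewrite orbmxE trmxK v2rK rmorph1 mul1mx. Qed.
End Orbit.

(** Lift the image of 1 and extend along the orbit of the lift. *)
Lemma reg_projective : projective regmod.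
Proof.
move=> M N g f hg sg hf; have [x xP] := sg (f *m (v2r (1 : A))^T).
exists (orbmx x); split; first exact: orb_hom.
apply: mulmx_cV_ext => y; rewrite -mulmxA orbmxE mulmxA hg -mulmxA -xP mulmxA -hf -mulmxA.
by rewrite [_ *m _^T]reg_actE trmxK v2rK mulr1 r2vK trmxK.
Qed.
End Regular.

(** M has finitely many elements; a free module of this rank maps onto it. *)
Lemma enough_projectives M : exists P : amod A, projective P /\
  exists e : 'M[k]_(mdim M, mdim P), mod_hom e /\ mx_surj e.
Proof.
have H (s : seq 'cV[k]_(mdim M)) : exists P : amod A, projective P /\
    exists e : 'M[k]_(mdim M, mdim P),
      mod_hom e /\ forall x, x \in s -> exists y, x = e *m y.
  elim: s => [|x s [P [pP [e [he eP]]]]].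
    exists (zero_amod A); split; first exact: zero_projective.
    by exists 0; split=> //; apply: mod_hom0.
  exists (dsum regmod P); split; first exact: dsum_projective reg_projective pP.
  exists (row_mx (orbmx x) e); split; first exact: mod_hom_row (orb_hom x) he.
  move=> z; rewrite inE => /predU1P[->|/eP[y ->]].
    have [y yP] := orb_mem x; exists (col_mx y 0).
    by rewrite [RHS]mul_row_col mulmx0 addr0.
  by exists (col_mx 0 y); rewrite [RHS]mul_row_col mulmx0 add0r.
have [P [pP [e [he eP]]]] := H (enum 'cV[k]_(mdim M)).
by exists P; split=> //; exists e; split=> // x; apply: eP; rewrite mem_enum.
Qed.

End ModuleConstructions.

(** * Spaces of homomorphisms *)

Section SpanClosed.
Context (k : fieldType) (vT : vectType k).

(** Spaces of homomorphisms are given as spans of finite enumerations; this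
    gives back the membership predicate. *)
Lemma span_linear_closed (s : seq vT) (P : vT -> Prop) :
  (forall x, x \in s <-> P x) -> P 0 -> (forall c x y, P x -> P y -> P (c *: x + y)) ->
  forall x, x \in <<s>>%VS <-> P x.
Proof.
move=> sP P0 PD x; split=> [/(@coord_span _ _ _ (in_tuple s)) ->|/sP/memv_span//].
apply: (big_rec P) => // i y _ Py; apply: PD => //; apply/sP; exact: mem_nth.
Qed.

End SpanClosed.

Section HomSpaces.
Context (k : finFieldType) (A : falgType k).
Implicit Types M N L P : amod A.

(** Encoded like [dim_hom], as the span of the finite set of its elements, which
    avoids solving the linear equations that define homomorphisms. *)
Definition homv M N : {vspace 'M[k]_(mdim N, mdim M)} :=
  <<enum [pred h | `[< @mod_hom k A M N h >]]>>%VS.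

Lemma homvP M N h : h \in homv M N <-> mod_hom h.
Proof.
apply: span_linear_closed; last first.
- by move=> c x y hx hy; apply: mod_homD => //; apply: mod_homZ.
- exact: mod_hom0.
- by move=> x; rewrite mem_enum inE; split=> [/asboolP|hx] //; apply/asboolP.
Qed.

Definition hdim M N := \dim (homv M N).

(** Hom(P, -) is exact: composition with g maps Hom(P, L) onto Hom(P, M),
    and its kernel is the image of Hom(P, N). *)
Lemma hdim_ses P N L M (f : 'M[k]_(mdim L, mdim N)) (g : 'M[k]_(mdim M, mdim L)) :
  projective P -> mod_ses f g -> hdim P L = (hdim P N + hdim P M)%N.
Proof.
move=> pP [hf hg jf fg sg].
pose G : 'Hom('M[k]_(mdim L, mdim P), 'M[k]_(mdim M, mdim P)) := linfun (mulmx g).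
pose F : 'Hom('M[k]_(mdim N, mdim P), 'M[k]_(mdim L, mdim P)) := linfun (mulmx f).
have GE x : G x = g *m x by rewrite lfunE.
have FE x : F x = f *m x by rewrite lfunE.
rewrite /hdim -(limg_ker_dim G (homv P L)).
have -> : (G @: homv P L = homv P M)%VS.
  apply/vspaceP => x; apply/memv_imgP/idP => [[y /homvP hy ->]|/homvP hx].
    by rewrite GE; apply/homvP/mod_homM.
  have [y [hy gy]] := pP _ _ _ _ hg sg hx.
  by exists y; [apply/homvP|rewrite GE gy].
have -> : (homv P L :&: lker G = F @: homv P N)%VS.
  apply/vspaceP => x; rewrite memv_cap memv_ker GE.
  apply/andP/memv_imgP => [[/homvP hx /eqP gx]|[y /homvP hy ->]].
    have [y xy] := mx_exact_factor fg gx; exists y; last by rewrite FE.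
    by apply/homvP; apply: (mod_hom_mono hf jf); rewrite -xy.
  rewrite FE mulmxA (mx_exact0 fg) mul0mx eqxx; split=> //.
  by apply/homvP; apply: mod_homM.
rewrite limg_dim_eq //; apply/eqP; rewrite -subv0; apply/subvP => x.
rewrite memv_cap memv_ker FE memv0 => /andP[_ /eqP fx].
by apply/eqP/(mx_injI jf); rewrite fx mulmx0.
Qed.

Lemma hdim_gt0 M N (h : 'M[k]_(mdim N, mdim M)) : mod_hom h -> h != 0 -> (0 < hdim M N)%N.
Proof.
move=> /homvP hh h0; rewrite lt0n dimv_eq0; apply: contraNneq h0 => e.
by rewrite -memv0 -e.
Qed.

Lemma hdim_eq0 M N : (forall h : 'M[k]_(mdim N, mdim M), mod_hom h -> h = 0) ->
  hdim M N = 0%N.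
Proof.
move=> H; apply/eqP; rewrite dimv_eq0 -subv0; apply/subvP => h /homvP/H ->.
exact: mem0v.
Qed.

End HomSpaces.

(** * Projective covers over a hereditary algebra *)

Section ProjectiveCover.
Context (k : finFieldType) (A : falgType k) (hA : hereditary A).
Implicit Types M N P : amod A.

(** A projective of least dimension mapping onto M works: the image of h is a
    submodule of P, hence projective as A is hereditary, and it still maps onto
    M, so that it is all of P by minimality. *)
Lemma projective_cover M : exists P (e : 'M[k]_(mdim M, mdim P)),
  [/\ projective P, mod_hom e, mx_surj e &
    forall N (h : 'M[k]_(mdim P, mdim N)),
      mod_hom h -> mx_surj (e *m h) -> mx_surj h].
Proof.
pose covers d := `[< exists P (e : 'M[k]_(mdim M, mdim P)),
  [/\ mdim P = d, projective P, mod_hom e & mx_surj e] >].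
have ex : exists d, covers d.
  have [P [pP [e [he se]]]] := enough_projectives M.
  by exists (mdim P); apply/asboolP; exists P, e.
case: (ex_minnP ex) => d /asboolP[P [e [dP pP he se]]] dmin.
exists P, e; split=> // N h hh seh.
have [I [i [p [hi hp ii sp hip]]]] := image_exists hh.
have sei : mx_surj (e *m i) by move: seh; rewrite hip mulmxA => /mx_surj_mull.
have leI : (mdim P <= mdim I)%N.
  rewrite dP; apply: dmin; apply/asboolP; exists I, (e *m i).
  by split=> //; [apply: hA hi ii pP|apply: mod_homM].
by rewrite hip; apply: mx_surj_mul (mx_inj_surj ii leI) sp.
Qed.

Lemma min_resolution_exists M : exists C e, min_resolution (M := M) (C := C) e.
Proof.
have [P [e [pP he se ess]]] := projective_cover M.
have [K [f [hf jf fe]]] := kernel_exists he.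
by exists (@C2P _ _ (PMod (hA hf jf pP)) (PMod pP) f hf), e; split.
Qed.

End ProjectiveCover.

(** * Simple modules *)

Section SimpleModules.
Context (k : finFieldType) (A : falgType k).
Implicit Types M N L P Q S T : amod A.

Lemma simple_hom_surj M S (f : 'M[k]_(mdim S, mdim M)) :
  simple_mod S -> mod_hom f -> f != 0 -> mx_surj f.
Proof.
move=> [_ sS] hf f0; have [I [i [p [hi hp ii sp e]]]] := image_exists hf.
case: (sS I i hi ii) => [I0|si]; last by rewrite e; apply: mx_surj_mul.
case/eqP: f0; rewrite e; apply/matrixP => x y; rewrite !mxE big1 // => z.
by have := ltn_ord z; rewrite {2}I0.
Qed.

Lemma mod_bij_iso M N (f : 'M[k]_(mdim N, mdim M)) :
  mod_hom f -> mx_inj f -> mx_surj f -> mod_iso M N.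
Proof.
move=> hf jf /mx_surjP[g fg]; exists f, g; split=> //.
  by apply: (mod_hom_mono hf jf); rewrite fg; apply: mod_hom_id.
by apply: (mx_injI jf); rewrite mulmxA fg mul1mx mulmx1.
Qed.

(** A projective cover of a simple module S has no other simple quotient. The
    kernel K of h is proper, so e cannot map K onto S (else K would be all of P,
    as e is essential); hence e vanishes on K and induces an isomorphism from
    T = P / K to S. *)
Lemma essential_simple_quotient P S T (e : 'M[k]_(mdim S, mdim P))
    (h : 'M[k]_(mdim T, mdim P)) :
  simple_mod S -> simple_mod T -> mod_hom e -> mx_surj e ->
  (forall N (u : 'M[k]_(mdim P, mdim N)), mod_hom u -> mx_surj (e *m u) -> mx_surj u) ->
  mod_hom h -> h != 0 -> mod_iso S T.
Proof.
move=> sS sT he se ess hh h0; have sh := simple_hom_surj sT hh h0.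
have [K [i [hi ii ih]]] := kernel_exists hh.
have ei0 : e *m i = 0.
  apply/eqP; apply: contraT => ei0.
  have := ess _ _ hi (simple_hom_surj sS (mod_homM he hi) ei0).
  move=> /mx_surjP[j ij]; case/eqP: h0.
  by rewrite -[h]mulmx1 -ij mulmxA (mx_exact0 ih) mul0mx.
have [s hs] := proj1 (mx_surjP h) sh.
(* s is only a linear section of h, but 1 - s h lands in K, where e vanishes. *)
have e_s : e = (e *m s) *m h.
  have [y yP] : exists y, 1%:M - s *m h = i *m y.
    by apply: (mx_exact_factor ih); rewrite mulmxBr mulmx1 mulmxA hs mul1mx subrr.
  apply/eqP; rewrite -subr_eq0 -mulmxA -[X in X - _]mulmx1 -mulmxBr yP mulmxA ei0.
  by rewrite mul0mx.
have hes : mod_hom (e *m s) by apply: (mod_hom_epi hh sh); rewrite -e_s.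
have ses : mx_surj (e *m s) by move: se; rewrite {1}e_s => /mx_surj_mull.
have [K' [i' [hi' ii' ih']]] := kernel_exists hes.
have jes : mx_inj (e *m s).
  case: (sT) => _ /(_ _ _ hi' ii')[K0|si'].
    move=> x /ih'[y ->]; apply/matrixP => a b; rewrite !mxE big1 // => z.
    by have := ltn_ord z; rewrite {2}K0.
  have es0 : e *m s = 0.
    by apply: (mx_surjI si'); rewrite (mx_exact0 ih') mul0mx.
  have [S0 _] := sS; move: ses; rewrite es0 => /mx_surj0_dim E.
  by rewrite E in S0.
have [f [g [hf hg gf fg]]] := mod_bij_iso hes jes ses.
by exists g, f.
Qed.

(** A nonzero quotient Q of least dimension is simple: the cokernel of a
    nonzero proper submodule of Q would be a smaller nonzero quotient. *)
Lemma simple_quotient M : (0 < mdim M)%N -> exists Q (g : 'M[k]_(mdim Q, mdim M)),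
  [/\ simple_mod Q, mod_hom g & mx_surj g].
Proof.
move=> M0; pose quot d := `[< exists Q (g : 'M[k]_(mdim Q, mdim M)),
  [/\ (0 < mdim Q)%N, mdim Q = d, mod_hom g & mx_surj g] >].
have ex : exists d, quot d.
  exists (mdim M); apply/asboolP; exists M, 1%:M; split=> //; first exact: mod_hom_id.
  by move=> y; exists y; rewrite mul1mx.
case: (ex_minnP ex) => d /asboolP[Q [g [Q0 dQ hg sg]]] dmin.
exists Q, g; split=> //; split=> // U f hf jf.
have [Q' [c [hc sc fc]]] := cokernel_exists hf.
have [Q'0|Q'0] := posnP (mdim Q'); [right|left].
  by move=> y; apply/fc/matrixP => i; have := ltn_ord i; rewrite {2}Q'0.
have leQ : (mdim Q <= mdim Q')%N.
  rewrite dQ; apply: dmin; apply/asboolP; exists Q', (c *m g).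
  by split=> //; [apply: mod_homM|apply: mx_surj_mul].
have f0 : f = 0.
  by apply: (mx_injI (mx_surj_inj sc leQ)); rewrite (mx_exact0 fc) mulmx0.
by move: jf; rewrite f0 => /mx_inj0_dim.
Qed.

End SimpleModules.

(** * Dimension vectors *)

Section DimensionVectors.
Context (k : finFieldType) (A : falgType k) (n : nat) (S : 'I_n -> amod A).
Context (hA : hereditary A) (hS : simple_system S).
Implicit Types M N L P Q : amod A.

(** The functor Hom(P, -) counts the composition factors isomorphic to S i. *)
Lemma projective_cover_simple i : exists P, [/\ projective P,
  (0 < hdim P (S i))%N & forall j, j != i -> hdim P (S j) = 0%N].
Proof.
have [sS iS _] := hS.
have [P [e [pP he se ess]]] := projective_cover hA (S i).
exists P; split=> // [|j ji].
  apply: (hdim_gt0 he); apply/eqP => e0; move: se; rewrite e0 => /mx_surj0_dim.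
  by have [+ _] := sS i; case: (mdim _).
apply: hdim_eq0 => h hh; apply/eqP; apply: contraT => h0.
by rewrite (iS i j (essential_simple_quotient (sS i) (sS j) he se ess hh h0)) eqxx in ji.
Qed.

Lemma comp_mult_hdim i P M m : projective P ->
  (forall j, j != i -> hdim P (S j) = 0%N) -> comp_mult S M m ->
  (hdim P M)%:Z = m i 0 * (hdim P (S i))%:Z.
Proof.
move=> pP Pj; elim=> {M m} [M M0|j N M m f g fg _ IH].
  rewrite mxE mul0r (_ : hdim P M = 0%N) //; apply: hdim_eq0 => h _.
  by apply/matrixP => a; have := ltn_ord a; rewrite {2}M0.
rewrite (hdim_ses pP fg) PoszD IH !mxE eqxx andbT mulrDl; congr (_ + _).
by have [->|/Pj ->] := eqVneq j i; [rewrite mul1r|rewrite mul0r].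
Qed.

(** Split off a simple quotient and induct on the dimension of its kernel. *)
Lemma comp_mult_exists M : exists m, comp_mult S M m.
Proof.
have [d] := ubnP (mdim M); elim: d M => // d IH M /ltnSE Md.
have [M0|M0] := posnP (mdim M); first by exists 0; apply: CompZero.
have [Q [g [sQ hg sg]]] := simple_quotient M0.
have [_ _ /(_ Q sQ)[i [f [f' [hf hf' f'f ff']]]]] := hS.
have hfg := mod_homM hf hg.
have sfg : mx_surj (f *m g) by apply: mx_surj_mul => //; apply/mx_surjP; exists f'.
have [N [u [hu ju ufg]]] := kernel_exists hfg.
have NM : (mdim N < mdim M)%N.
  rewrite ltnNge; apply/negP => /(mx_inj_surj ju) su.
  have fg0 : f *m g = 0 by apply: (mx_surjI su); rewrite (mx_exact0 ufg) mul0mx.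
  have [/(_ i)[+ _] _ _] := hS; move: sfg; rewrite fg0 => /mx_surj0_dim ->.
  by [].
have [m Nm] := IH N (leq_trans NM Md).
by exists (m + delta_mx i 0); apply: CompStep Nm; split; try eassumption.
Qed.

Lemma dimvecP M : comp_mult S M (dimvec S M).
Proof. exact: xgetPex (comp_mult_exists M). Qed.

(** The dimensions of the Hom(P_i, -) add up, and dim Hom(P_i, S_i) > 0 can be
    cancelled. *)
Lemma dimvec_ses N L M (f : 'M[k]_(mdim L, mdim N)) (g : 'M[k]_(mdim M, mdim L)) :
  mod_ses f g -> dimvec S L = dimvec S N + dimvec S M.
Proof.
move=> fg; apply/matrixP => i j; rewrite ord1 {j}.
have [P [pP P0 Pj]] := projective_cover_simple i.
have := hdim_ses pP fg => /(congr1 Posz); rewrite PoszD.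
have dE X := comp_mult_hdim pP Pj (dimvecP X).
rewrite (dE L) (dE N) (dE M) -mulrDl [X in _ -> _ = X]mxE.
by move/mulIf => -> //; rewrite eqz_nat -lt0n.
Qed.

Lemma comp_mult_dimvec M m : comp_mult S M m -> dimvec S M = m.
Proof.
move=> Mm; apply/matrixP => i j; rewrite ord1 {j}.
have [P [pP P0 Pj]] := projective_cover_simple i.
have := comp_mult_hdim pP Pj (dimvecP M); rewrite (comp_mult_hdim pP Pj Mm).
by move/mulIf => -> //; rewrite eqz_nat -lt0n.
Qed.

Lemma dimvec0 M : mdim M = 0%N -> dimvec S M = 0.
Proof. by move=> M0; apply/comp_mult_dimvec/CompZero. Qed.

Lemma dimvec_simple i : dimvec S (S i) = delta_mx i 0.
Proof.
apply: comp_mult_dimvec; rewrite -[delta_mx i 0]add0r.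
apply: (CompStep (N := zero_amod A) (f := 0) (g := 1%:M)); last exact: CompZero.
split; [exact: mod_hom0|exact: mod_hom_id|by move=> x _; apply/matrixP => -[]|..].
  move=> x; rewrite mul1mx; split=> [->|[y ->]]; last by rewrite mul0mx.
  by exists 0; rewrite mulmx0.
by move=> y; exists y; rewrite mul1mx.
Qed.

Lemma dimvec_bij M N (f : 'M[k]_(mdim N, mdim M)) :
  mod_hom f -> mx_inj f -> mx_surj f -> dimvec S M = dimvec S N.
Proof.
move=> hf jf sf; have ses : @mod_ses _ _ (zero_amod A) M N 0 f.
  split=> //; first exact: mod_hom0.
    by move=> x _; apply/matrixP => -[].
  move=> x; split=> [/jf ->|[y ->]]; last by rewrite mul0mx mulmx0.
  by exists 0; rewrite mulmx0.
by rewrite (dimvec_ses ses) dimvec0 ?add0r.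
Qed.

(** The set of such differences is a subgroup, and it contains the class of
    each simple module by its projective resolution. *)
Lemma projective_classes_generate (a : 'cV[int]_n) :
  exists P Q : pmod A, a = dimvec S P - dimvec S Q.
Proof.
pose T (a : 'cV[int]_n) := exists P Q : pmod A, a = dimvec S P - dimvec S Q.
have T0 : T 0 by exists (zero_pmod A), (zero_pmod A); rewrite subrr.
have TD a1 a2 : T a1 -> T a2 -> T (a1 + a2).
  move=> [P1 [Q1 ->]] [P2 [Q2 ->]].
  exists (PMod (dsum_projective (@pmodP _ _ P1) (@pmodP _ _ P2))).
  exists (PMod (dsum_projective (@pmodP _ _ Q1) (@pmodP _ _ Q2))).
  by rewrite !(dimvec_ses (dsum_ses _ _)) addrACA -opprD.
have TN a1 : T a1 -> T (- a1) by move=> [P [Q ->]]; exists Q, P; rewrite opprB.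
have TMn a1 m : T a1 -> T (a1 *+ m).
  by move=> Ta; elim: m => [|m IH] //; rewrite mulrS; apply: TD.
have Ti i : T (delta_mx i 0).
  have [C [e [ses _]]] := min_resolution_exists hA (S i).
  exists (tgt C), (src C); rewrite (dimvec_ses ses) addrC addKr.
  by rewrite dimvec_simple.
rewrite [a]matrix_sum_delta; apply: (big_ind T) => // i _.
apply: (big_ind T) => // j _; rewrite ord1.
case: (a i 0) => m; first by rewrite -[Posz m]natz scaler_nat; apply: TMn.
by rewrite NegzE -[Posz _]natz scaleNr scaler_nat; apply/TN/TMn.
Qed.

End DimensionVectors.

(** * Extensions in the category of two-term complexes *)

Section BaerMatrices.
Context (k : finFieldType).

(** One degree of the Baer sum. The maps h1 and h2 trivialize two extensions
    of M by N, whose pullback over M is then N + (N + M): the second extension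
    is the inner summand, and the first one sees the outer copy of N and the
    M-component. *)
Section Degree.
Context (n m l1 l2 l : nat).
Context (h1 : 'M[k]_(l1, n + m)) (g1 : 'M[k]_(n + m, l1)) (p1 : 'M[k]_(m, l1)).
Context (h2 : 'M[k]_(l2, n + m)) (g2 : 'M[k]_(n + m, l2)) (p2 : 'M[k]_(m, l2)).
Context (h1g1 : h1 *m g1 = 1%:M) (g1h1 : g1 *m h1 = 1%:M).
Context (h2g2 : h2 *m g2 = 1%:M) (g2h2 : g2 *m h2 = 1%:M).
Context (p1h1 : p1 *m h1 = prr_mx) (p2h2 : p2 *m h2 = prr_mx).

Lemma std_pullback :
  is_pullback p1 p2 (h1 *m row_mx (inl_mx) (inr_mx *m prr_mx))
                    (h2 *m row_mx 0 1%:M).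
Proof.
split=> [|x1 x2 px].
  rewrite !mulmxA p1h1 p2h2 mul_mx_row mulmxA prr_inl prr_inr mul1mx.
  by rewrite mul_mx_row mulmx0 mulmx1.
have E : prr_mx *m (g2 *m x2) = prr_mx *m (g1 *m x1).
  rewrite -[in LHS]p2h2 -[in RHS]p1h1 -!mulmxA (mulmxA h2) (mulmxA h1).
  by rewrite h1g1 h2g2 !mul1mx px.
exists (col_mx (prl_mx *m (g1 *m x1)) (g2 *m x2)); split.
  rewrite -!mulmxA !mul_row_col mul0mx add0r mul1mx (mulmxA h2) h2g2 mul1mx; split=> //.
  rewrite -(mulmxA inr_mx) E (mulmxA inl_mx) (mulmxA inr_mx) -mulmxDl.
  by rewrite inl_inr_sum mul1mx mulmxA h1g1 mul1mx.
move=> z [z1 z2]; rewrite -[z]vsubmxK in z1 z2 *.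
move: z1 z2; rewrite -!mulmxA !mul_row_col mul0mx add0r mul1mx => z1 z2.
have -> : dsubmx z = g2 *m x2 by rewrite -z2 mulmxA g2h2 mul1mx.
congr col_mx; rewrite -z1 (mulmxA g1) g1h1 mul1mx mulmxDr !mulmxA.
by rewrite prl_inl prl_inr !mul0mx mul1mx addr0.
Qed.

Lemma std_folds (h : 'M[k]_(l, n + m)) :
  folds (h1 *m inl_mx) (h2 *m inl_mx) (h *m inl_mx)
    (h1 *m row_mx (inl_mx) (inr_mx *m prr_mx))
    (h2 *m row_mx 0 1%:M) (h *m row_mx (inl_mx) 1%:M).
Proof.
move=> z y1 y2; rewrite -[z]vsubmxK -!mulmxA !mul_row_col mul0mx add0r !mul1mx.
move=> /(congr1 (mulmx g1)); rewrite !(mulmxA g1) g1h1 !mul1mx => e1.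
move=> /(congr1 (mulmx g2)); rewrite !(mulmxA g2) g2h2 !mul1mx => ->.
move/(congr1 (mulmx (prl_mx))): e1.
rewrite mulmxDr !mulmxA prl_inl prl_inr !mul0mx !mul1mx addr0 => ->.
by rewrite -!mulmxA -mulmxDr.
Qed.
End Degree.

End BaerMatrices.
Section StandardExtensions.
Context (k : finFieldType) (A : falgType k).
Implicit Types M N L : c2p A.

Notation mor M N := ('M[k]_(mdim (src N), mdim (src M)) *
                     'M[k]_(mdim (tgt N), mdim (tgt M)))%type.

Lemma mor_ext M N (h g : mor M N) : h.1 = g.1 -> h.2 = g.2 -> h = g.
Proof. by case: h g => [h1 h2] [g1 g2] /= -> ->. Qed.

(** A degreewise inverse of a morphism is a morphism. *)
Lemma inverse_is_mor M N (h : mor M N) (g : mor N M) :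
  is_mor h -> mor_comp g h = mor_id M -> mor_comp h g = mor_id N ->
  inverse_mors h g.
Proof.
move=> mh gh hg; split=> //; case: mh => h1 h2 hd.
case: gh => g1h1 g2h2; case: hg => h1g1 h2g2; split.
- apply: (mod_hom_mono h1); first by apply/mx_injP; exists g.1.
  by rewrite h1g1; apply: mod_hom_id.
- apply: (mod_hom_mono h2); first by apply/mx_injP; exists g.2.
  by rewrite h2g2; apply: mod_hom_id.
- apply: (@mx_injI _ _ _ _ h.2); first by apply/mx_injP; exists g.2.
  by rewrite !mulmxA h2g2 mul1mx hd -mulmxA h1g1 mulmx1.
Qed.

Definition pdsum (P Q : pmod A) : pmod A :=
  PMod (dsum_projective (@pmodP _ _ P) (@pmodP _ _ Q)).

Section Std.
Context (M N : c2p A).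

(** The extension with cocycle t: degreewise it is N + M, and t is the only
    component of the differential that is not given by M and N. *)
Definition std_dif (t : 'M[k]_(mdim (tgt N), mdim (src M))) :
    'M[k]_(mdim (tgt N) + mdim (tgt M), mdim (src N) + mdim (src M)) :=
  block_mx (dif N) t 0 (dif M).

Lemma std_dif_hom t : @mod_hom _ _ (src M) (tgt N) t ->
  @mod_hom _ _ (pdsum (src N) (src M)) (pdsum (tgt N) (tgt M)) (std_dif t).
Proof.
move=> ht; rewrite /std_dif block_mxEh; apply: mod_hom_row; apply: mod_hom_col => //;
  try exact: difP; exact: mod_hom0.
Qed.

Lemma std_dif_inl t : std_dif t *m inl_mx = inl_mx *m dif N.
Proof. by rewrite mul_block_col mul_col_mx !mulmx0 !mulmx1 mul1mx !mul0mx !addr0. Qed.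

Lemma std_dif_inr t : std_dif t *m inr_mx = inl_mx *m t + inr_mx *m dif M.
Proof.
by rewrite mul_block_col !mul_col_mx add_col_mx !mulmx0 !mulmx1 !mul1mx !mul0mx !add0r addr0.
Qed.

Lemma prr_std_dif t : prr_mx *m std_dif t = dif M *m prr_mx.
Proof. by rewrite mul_row_block mul_mx_row !mulmx0 !mul0mx mulmx1 mul1mx !add0r. Qed.

Context (t : 'M[k]_(mdim (tgt N), mdim (src M))) (ht : @mod_hom _ _ (src M) (tgt N) t).

Definition stdC : c2p A := C2P (std_dif_hom ht).

Definition std_inc : mor N stdC := (inl_mx, inl_mx).
Definition std_prj : mor stdC M := (prr_mx, prr_mx).

Lemma std_inc_mor : is_mor std_inc.
Proof.
split; [exact: mod_hom_inl|exact: mod_hom_inl|].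
by rewrite [RHS]std_dif_inl.
Qed.

Lemma std_prj_mor : is_mor std_prj.
Proof.
split; [exact: mod_hom_prr|exact: mod_hom_prr|].
by rewrite [LHS]prr_std_dif.
Qed.

Definition stdE : ext M N :=
  @Ext k A M N stdC std_inc std_prj std_inc_mor std_prj_mor
       (dsum_ses (src N) (src M)) (dsum_ses (tgt N) (tgt M)).

End Std.

(** A sequence that ends in a projective splits, with both the section s and
    the retraction r module homomorphisms. *)
Lemma ses_split (P N L : amod A) (i : 'M[k]_(mdim L, mdim N)) (p : 'M[k]_(mdim P, mdim L)) :
  projective P -> mod_ses i p ->
  exists (s : 'M[k]_(mdim L, mdim P)) (r : 'M[k]_(mdim N, mdim L)),
    [/\ mod_hom s, mod_hom r, p *m s = 1%:M, r *m i = 1%:M & r *m s = 0] /\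
    i *m r + s *m p = 1%:M.
Proof.
move=> pP [hi hp ji ip sp]; have [s [hs ps]] := pP _ _ _ _ hp sp (mod_hom_id P).
have [r rP] : exists r, 1%:M - s *m p = i *m r.
  by apply: (mx_exact_factor ip); rewrite mulmxBr mulmx1 mulmxA ps mul1mx subrr.
have pi0 := mx_exact0 ip.
exists s, r; split; last by rewrite -rP subrK.
split=> //.
- apply: (mod_hom_mono hi ji); rewrite -rP; apply: mod_homB; first exact: mod_hom_id.
  exact: mod_homM.
- apply: (mx_injI ji).
  by rewrite mulmxA -rP mulmxBl mul1mx -mulmxA pi0 mulmx0 subr0 mulmx1.
- apply: (mx_injI ji).
  by rewrite mulmxA -rP mulmxBl mul1mx -mulmxA ps mulmx0 mulmx1 subrr.
Qed.

(** An equivalence of extensions is the identity on N and modulo N, hence of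
    this unitriangular form in each degree. *)
Lemma unitri_hom (P Q : amod A) (u : 'M[k]_(mdim Q, mdim P)) : mod_hom u ->
  @mod_hom _ _ (dsum Q P) (dsum Q P) (row_mx inl_mx (inl_mx *m u + inr_mx)).
Proof.
move=> hu; apply: mod_hom_row; first exact: mod_hom_inl.
apply: mod_homD; last exact: mod_hom_inr.
exact: (mod_homM (mod_hom_inl Q P) hu).
Qed.

Section Classification.
Context (M N : c2p A).

(** The middle term splits in both degrees, M having projective terms. With
    respect to these splittings the differential is block triangular, with
    corner r2 d s1. *)
Lemma ext_standard (E : ext M N) :
  exists t (ht : @mod_hom _ _ (src M) (tgt N) t), ext_eqv (stdE ht) E.
Proof.
have [s1 [r1 [[hs1 hr1 p1s1 r1i1 r1s1] e1]]] := ses_split (@pmodP _ _ (src M)) (ext_ses1 E).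
have [s2 [r2 [[hs2 hr2 p2s2 r2i2 r2s2] e2]]] := ses_split (@pmodP _ _ (tgt M)) (ext_ses2 E).
have [hi1 hi2 di] := einc_mor E; have [hp1 hp2 dp] := eprj_mor E.
have ht : @mod_hom _ _ (src M) (tgt N) (r2 *m dif (emid E) *m s1).
  by apply: mod_homM => //; apply: mod_homM => //; apply: difP.
exists _, ht; apply/asboolP.
exists (row_mx (einc E).1 s1, row_mx (einc E).2 s2).
exists (col_mx r1 (eprj E).1, col_mx r2 (eprj E).2).
have pi1 : (eprj E).1 *m (einc E).1 = 0 by case: (ext_ses1 E) => _ _ _ /mx_exact0.
have pi2 : (eprj E).2 *m (einc E).2 = 0 by case: (ext_ses2 E) => _ _ _ /mx_exact0.
split; last first.
- by apply: mor_ext; rewrite /= mul_mx_row ?pi1 ?pi2 ?p1s1 ?p2s2.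
- by apply: mor_ext; rewrite /= mul_row_inl.
apply: inverse_is_mor.
- split; [exact: mod_hom_row|exact: mod_hom_row|].
  rewrite /= mul_row_block mul_mx_row mulmx0 addr0 di; congr row_mx.
  rewrite !mulmxA -[X in X *m _ *m _ + _](addrK (s2 *m (eprj E).2)) e2.
  rewrite !mulmxBl mul1mx -[_ *m _ *m dif _]mulmxA dp -!mulmxA p1s1 mulmx1.
  by rewrite subrK.
- by apply: mor_ext; rewrite /= mul_col_row ?r1i1 ?r2i2 ?r1s1 ?r2s2 ?pi1 ?pi2 ?p1s1 ?p2s2
    -scalar_mx_block.
- by apply: mor_ext; rewrite /= mul_row_col.
Qed.

(** A unitriangular pair with corners (u, w) commutes with the differentials
    of the two standard extensions exactly when t + w d_M = d_N u + t'. *)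
Lemma std_eqvP t t' (ht : @mod_hom _ _ (src M) (tgt N) t)
    (ht' : @mod_hom _ _ (src M) (tgt N) t') :
  ext_eqv (stdE ht) (stdE ht') <->
  exists (u : 'M_(mdim (src N), mdim (src M))) (w : 'M_(mdim (tgt N), mdim (tgt M))),
    [/\ mod_hom u, mod_hom w & t - t' = dif N *m u - w *m dif M].
Proof.
split=> [/asboolP[h [g [[[hh1 hh2 hd] _ _ _] [hi1 hi2] [hp1 hp2]]]]|[u [w [hu hw e]]]].
  exists (prl_mx *m h.1 *m inr_mx), (prl_mx *m h.2 *m inr_mx); split.
  - exact: (mod_homM (mod_homM (mod_hom_prl (src N) (src M)) hh1)
                     (mod_hom_inr (src N) (src M))).
  - exact: (mod_homM (mod_homM (mod_hom_prl (tgt N) (tgt M)) hh2)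
                     (mod_hom_inr (tgt N) (tgt M))).
  set u := prl_mx *m h.1 *m inr_mx; set w := prl_mx *m h.2 *m inr_mx.
  have hr1 : h.1 *m inr_mx = inl_mx *m u + inr_mx.
    rewrite -[LHS]mul1mx -inl_inr_sum mulmxDl -!mulmxA; congr (_ + _); first by rewrite /u -mulmxA.
    by rewrite (mulmxA prr_mx) hp1 prr_inr mulmx1.
  have := congr1 (fun f => prl_mx *m (f *m inr_mx)) hd.
  rewrite /= -!mulmxA std_dif_inr hr1 !mulmxDr.
  rewrite (mulmxA h.2 inl_mx) hi2 !(mulmxA _ inl_mx) ![std_dif _ *m inl_mx]std_dif_inl.
  rewrite std_dif_inr mulmxDr !mulmxA !prl_inl prl_inr !mul1mx mul0mx addr0.
  rewrite -[prl_mx *m h.2 *m inr_mx]/w => e.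
  by apply/eqP; rewrite subr_eq addrAC -e addrK.
apply/asboolP.
exists (row_mx inl_mx (inl_mx *m u + inr_mx), row_mx inl_mx (inl_mx *m w + inr_mx)).
exists (row_mx inl_mx (inl_mx *m - u + inr_mx), row_mx inl_mx (inl_mx *m - w + inr_mx)).
have hr m n (x y : 'M[k]_(m, n)) : 
   y = - x -> row_mx inl_mx (inl_mx *m x + inr_mx) *m row_mx inl_mx (inl_mx *m y + inr_mx) = 1%:M.
  move=> ->; rewrite mul_mx_row mul_row_inl mulmxDr mulmxA mul_row_inl mul_row_inr.
  by rewrite mulmxN addKr row_inl_inr.
split.
- apply: inverse_is_mor.
  + split; last first.
      apply: row_mx_ext; rewrite -!mulmxA /=.
        by rewrite mul_row_inl ![std_dif _ *m inl_mx]std_dif_inl mulmxA mul_row_inl.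
      have e' : t + w *m dif M = dif N *m u + t'.
        by apply/eqP; rewrite eq_sym -subr_eq addrAC -e subrK.
      rewrite mul_row_inr std_dif_inr !mulmxDr std_dif_inr !mulmxA mul_row_inl mul_row_inr.
      rewrite ![std_dif _ *m inl_mx]std_dif_inl mulmxDl addrA -!mulmxA -mulmxDr e'.
      by rewrite mulmxDr addrA.
    * exact: unitri_hom hw.
    * exact: unitri_hom hu.
  + by apply: mor_ext; rewrite /= hr // opprK.
  + by apply: mor_ext; rewrite /= hr.
- by apply: mor_ext; rewrite /= mul_row_inl.
- by apply: mor_ext; rewrite /= mul_mx_row mulmxDr mulmxA prr_inl prr_inr mul0mx add0r.
Qed.

End Classification.
End StandardExtensions.

(** * Ext^1 as a vector space *)

Section BaerStructure.
Context (k : finFieldType) (A : falgType k) (M N : c2p A).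
Implicit Types E : ext M N.

Notation mor M N := ('M[k]_(mdim (src N), mdim (src M)) *
                     'M[k]_(mdim (tgt N), mdim (tgt M)))%type.
Notation coc t := (@mod_hom k A (src M) (tgt N) t).

(** The pullback of two standard extensions is the standard extension of the
    second one by N, with the cocycle of the first one pulled back to it. Adding
    the two copies of N maps it onto the extension with cocycle t1 + t2. *)
Lemma baer_sum_std t1 t2 (ht1 : coc t1) (ht2 : coc t2) (ht : coc (t1 + t2)) E1 E2 E :
  ext_eqv (stdE ht1) E1 -> ext_eqv (stdE ht2) E2 -> ext_eqv (stdE ht) E ->
  baer_sum E1 E2 E.
Proof.
move=> /asboolP[h1 [g1 [[mh1 _ gh1 hg1] hi1 hp1]]].
move=> /asboolP[h2 [g2 [[mh2 _ gh2 hg2] hi2 hp2]]].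
move=> /asboolP[h [_ [[mh _ _ _] hi hp]]].
have ht1' : @mod_hom k A (src (stdC ht2)) (tgt N) (t1 *m prr_mx).
  exact: (mod_homM ht1 (mod_hom_prr (src N) (src M))).
exists (@stdC _ _ (stdC ht2) N _ ht1').
(* c1 and c2 are the projections of the pullback, and c adds the copies of N. *)
pose c1 m n := row_mx inl_mx (inr_mx *m prr_mx) : 'M[k]_(n + m, n + (n + m)).
pose c2 m n := row_mx 0 1%:M : 'M[k]_(n + m, n + (n + m)).
pose c m n := row_mx inl_mx 1%:M : 'M[k]_(n + m, n + (n + m)).
exists (h1.1 *m c1 _ _, h1.2 *m c1 _ _).
exists (h2.1 *m c2 _ _, h2.2 *m c2 _ _).
exists (h.1 *m c _ _, h.2 *m c _ _).
have hom1 (P Q : amod A) : @mod_hom _ _ (dsum Q (dsum Q P)) (dsum Q P) (c1 _ _).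
  apply: mod_hom_row; first exact: mod_hom_inl.
  exact: (mod_homM (mod_hom_inr Q P) (mod_hom_prr Q P)).
have hom2 (P Q : amod A) : @mod_hom _ _ (dsum Q (dsum Q P)) (dsum Q P) (c2 _ _).
  by apply: mod_hom_row; [apply: mod_hom0|apply: mod_hom_id].
have hom (P Q : amod A) : @mod_hom _ _ (dsum Q (dsum Q P)) (dsum Q P) (c _ _).
  by apply: mod_hom_row; [apply: mod_hom_inl|apply: mod_hom_id].
have dinl : dif (stdC ht1') *m inl_mx = inl_mx *m dif N := std_dif_inl _.
have dinr : dif (stdC ht1') *m inr_mx = inl_mx *m (t1 *m prr_mx) + inr_mx *m std_dif t2.
  exact: std_dif_inr.
have mc1 : @is_mor _ _ (stdC ht1') (stdC ht1) (c1 _ _, c1 _ _).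
  split; [exact: hom1|exact: hom1|].
  apply: row_mx_ext.
    by rewrite -[LHS]mulmxA dinl mulmxA mul_row_inl -mulmxA mul_row_inl std_dif_inl.
  rewrite -[LHS]mulmxA dinr -[RHS]mulmxA mul_row_inr mulmxDr !mulmxA mul_row_inl mul_row_inr.
  by rewrite std_dif_inr mulmxDl -!mulmxA prr_std_dif.
have mc2 : @is_mor _ _ (stdC ht1') (stdC ht2) (c2 _ _, c2 _ _).
  split; [exact: hom2|exact: hom2|].
  apply: row_mx_ext.
    by rewrite -[LHS]mulmxA dinl mulmxA mul_row_inl -mulmxA mul_row_inl mul0mx mulmx0.
  rewrite -[LHS]mulmxA dinr -[RHS]mulmxA mul_row_inr mulmxDr !mulmxA mul_row_inl mul_row_inr.
  by rewrite !mul0mx add0r mul1mx mulmx1.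
have mc : @is_mor _ _ (stdC ht1') (stdC ht) (c _ _, c _ _).
  split; [exact: hom|exact: hom|].
  apply: row_mx_ext.
    by rewrite -[LHS]mulmxA dinl mulmxA mul_row_inl -mulmxA mul_row_inl std_dif_inl.
  rewrite -[LHS]mulmxA dinr -[RHS]mulmxA mul_row_inr mulmxDr !mulmxA mul_row_inl mul_row_inr.
  rewrite mul1mx mulmx1; apply: row_mx_ext; rewrite mulmxDl -!mulmxA.
    by rewrite prr_inl !mulmx0 add0r !std_dif_inl.
  by rewrite prr_inr mulmx1 !std_dif_inr mulmxDr addrA.
case: gh1 => g1h1_1 g1h1_2; case: hg1 => h1g1_1 h1g1_2.
case: gh2 => g2h2_1 g2h2_2; case: hg2 => h2g2_1 h2g2_2.
split; [split|split|..].
- exact: (is_mor_comp mh1 mc1).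
- exact: (is_mor_comp mh2 mc2).
- exact: (is_mor_comp mh mc).
- exact: (std_pullback h1g1_1 g1h1_1 h2g2_1 g2h2_1 (congr1 fst hp1) (congr1 fst hp2)).
- exact: (std_pullback h1g1_2 g1h1_2 h2g2_2 g2h2_2 (congr1 snd hp1) (congr1 snd hp2)).
- have E0 m n : prr_mx *m c m n = prr_mx *m c1 m n.
    rewrite mul_mx_row prr_inl mulmx1 [RHS]mul_mx_row mulmxA prr_inr mul1mx.
    by rewrite prr_inl.
  have e1 := congr1 fst hp; have e2 := congr1 snd hp.
  have f1 := congr1 fst hp1; have f2 := congr1 snd hp1.
  rewrite /= in e1 e2 f1 f2.
  by apply: mor_ext; rewrite /= !mulmxA ?e1 ?e2 ?f1 ?f2 E0.
- rewrite -hi1 -hi2 -hi; split.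
    exact: (std_folds g1h1_1 g2h2_1 h.1).
  exact: (std_folds g1h1_2 g2h2_2 h.2).
Qed.

(** Multiplication by a on N and the identity on M. *)
Lemma baer_scale_std a t (ht : coc t) (hat : coc (a *: t)) E E' :
  ext_eqv (stdE ht) E -> ext_eqv (stdE hat) E' -> baer_scale a E E'.
Proof.
move=> /asboolP[h [g [[mh mg gh hg] hi hp]]] /asboolP[h' [_ [[mh' _ _ _] hi' hp']]].
pose c m n := row_mx (a *: inl_mx) inr_mx : 'M[k]_(n + m, n + m).
have hom (P Q : amod A) : @mod_hom _ _ (dsum Q P) (dsum Q P) (c _ _).
  by apply: mod_hom_row; [apply: mod_homZ; apply: mod_hom_inl|apply: mod_hom_inr].
have mc : @is_mor _ _ (stdC ht) (stdC hat) (c _ _, c _ _).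
  split; [exact: hom|exact: hom|].
  apply: row_mx_ext; rewrite /= -!mulmxA.
    rewrite [std_dif _ *m inl_mx]std_dif_inl mulmxA !mul_row_inl -scalemxAr.
    by rewrite [std_dif _ *m inl_mx]std_dif_inl scalemxAl.
  rewrite [std_dif _ *m inr_mx]std_dif_inr mul_row_inr mulmxDr !mulmxA.
  rewrite mul_row_inl mul_row_inr [std_dif _ *m inr_mx]std_dif_inr.
  by rewrite -scalemxAl -scalemxAr.
pose cm : mor (stdC ht) (stdC hat) :=
  (c (mdim (src M)) (mdim (src N)), c (mdim (tgt M)) (mdim (tgt N))).
exists (mor_comp h' (mor_comp cm g)); split.
- by apply: is_mor_comp => //; apply: is_mor_comp.
- rewrite -!mor_compA -hi (mor_compA g) gh mor_comp1l -hi'.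
  by apply: mor_ext; rewrite /= mul_row_inl -scalemxAr.
- rewrite mor_compA hp' mor_compA (_ : mor_comp _ cm = mor_comp (eprj E) h).
    by rewrite -mor_compA hg mor_comp1r.
  by rewrite hp; apply: mor_ext; rewrite /= mul_mx_row -scalemxAr prr_inl prr_inr scaler0.
Qed.

Notation cocycles := (homv (src M) (tgt N)).

Definition coboundaries : {vspace 'M[k]_(mdim (tgt N), mdim (src M))} :=
  (linfun (mulmx (dif N)) @: homv (src M) (src N) +
   linfun (mulmxr (dif M)) @: homv (tgt M) (tgt N))%VS.

Lemma coboundariesP t : t \in coboundaries <->
  exists (u : 'M_(mdim (src N), mdim (src M))) (w : 'M_(mdim (tgt N), mdim (tgt M))),
    [/\ mod_hom u, mod_hom w & t = dif N *m u - w *m dif M].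
Proof.
split=> [/memv_addP[_ /memv_imgP[u /homvP hu ->] [_ /memv_imgP[w /homvP hw ->] ->]]|].
  by exists u, (- w); split=> //; [apply: mod_homN|rewrite !lfunE mulNmx opprK].
move=> [u [w [hu hw ->]]]; apply: memv_add; apply/memv_imgP.
  by exists u; [apply/homvP|rewrite lfunE].
by exists (- w); [apply/homvP/mod_homN|rewrite lfunE /= mulNmx].
Qed.

Lemma coboundaries_sub : (coboundaries <= cocycles)%VS.
Proof.
apply/subvP => t /coboundariesP[u [w [hu hw ->]]]; apply/homvP.
by apply: mod_homB; apply: mod_homM => //; apply: difP.
Qed.

Import VectorInternalTheory.

(** By [std_eqvP], cocycles modulo coboundaries classify extensions, and a
    complement C of the coboundaries in the cocycles meets each class once. *)
Lemma has_dim_ext_exists : exists d, has_dim_ext M N d.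
Proof.
pose C := (cocycles :\: coboundaries)%VS.
have CB0 : (C :&: coboundaries)%VS = 0%VS by apply: capv_diff.
have CB : (C + coboundaries)%VS = cocycles.
  by rewrite addv_diff; apply/addv_idPl/coboundaries_sub.
have cocC (x : subvs_of C) : coc (val x).
  by apply/homvP; rewrite -CB; apply: subvP (addvSl _ _) _ (subvsP x).
pose dec (x : 'rV[k]_(\dim C)) : subvs_of C := @r2v _ (subvs_of C) x.
pose phi x : Ext1 M N := \pi_(Ext1 M N) (stdE (cocC (dec x))).
have phiE x : ext_eqv (stdE (cocC (dec x))) (repr (phi x)).
  by apply/eqmodP; rewrite reprK.
have phi_inj : injective phi.
  move=> x y /eqmodP /std_eqvP /coboundariesP xyB.
  have : val (dec x) - val (dec y) \in (C :&: coboundaries)%VS.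
    by rewrite memv_cap xyB andbT; apply: memvB; apply: subvsP.
  rewrite CB0 memv0 subr_eq0 => /eqP xy.
  by apply: (@r2v_inj _ (subvs_of C)); apply: val_inj xy.
have phi_surj e : exists x, phi x = e.
  have [t [ht te]] := ext_standard (repr e).
  have : t \in cocycles by apply/homvP.
  rewrite -CB => /memv_addP[c cC [b bB tcb]].
  exists (v2r (Subvs cC)); rewrite -[e]reprK; apply/eqmodP.
  apply: equiv_trans te; apply/std_eqvP/coboundariesP.
  by rewrite /dec v2rK /= tcb opprD addNKr memvN.
exists (\dim C), phi; split.
- have [psi psiP] := choice phi_surj.
  by exists psi => [x|//]; apply: phi_inj; rewrite psiP.
- move=> x y.
  have hxy : coc (val (dec x) + val (dec y)) by apply: mod_homD.
  apply: (baer_sum_std (phiE x) (phiE y) (ht := hxy)).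
  have := phiE (x + y); congr ext_eqv.
  move: (cocC _); rewrite /dec linearD /= => h.
  by congr stdE; apply: Prop_irrelevance.
- move=> c x.
  have hcx : coc (c *: val (dec x)) by apply: mod_homZ.
  apply: (baer_scale_std (phiE x) (hat := hcx)).
  have := phiE (c *: x); congr ext_eqv.
  move: (cocC _); rewrite /dec linearZ /= => h.
  by congr stdE; apply: Prop_irrelevance.
Qed.

End BaerStructure.

(** * Cardinalities of Hom and Ext^1 *)

Section Counting.

Lemma sum_count_undup (T : eqType) (s : seq T) :
  (\sum_(x <- undup s) count_mem x s)%N = size s.
Proof.
under eq_bigr do rewrite -sum1_count big_mkcond.
rewrite exchange_big -[RHS]sum1_size; apply: eq_big_seq => x xs /=.
rewrite -big_mkcond sum1_count (eq_count (a2 := pred1 x)); last by move=> y; rewrite /= eq_sym.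
by rewrite count_uniq_mem ?undup_uniq // mem_undup xs.
Qed.

Section Ext.
Context (k : finFieldType) (A : falgType k) (M N : c2p A).

Lemma card_homset : #|homset M N| = (#|k| ^ dim_hom M N)%N.
Proof.
rewrite -card_vspace; apply: eq_card => h; rewrite inE.
apply/asboolP/idP => [mh|].
  by apply: memv_span; rewrite mem_enum inE; apply/asboolP.
apply: (proj1 (span_linear_closed (P := @is_mor _ _ M N) _ _ _ h)).
- by move=> x; rewrite mem_enum inE; split=> [/asboolP|mx] //; apply/asboolP.
- by split; rewrite ?mul0mx ?mulmx0 //; apply: mod_hom0.
- move=> c x y [x1 x2 xd] [y1 y2 yd]; split.
  + by apply: mod_homD => //; apply: mod_homZ.
  + by apply: mod_homD => //; apply: mod_homZ.
  + by rewrite mulmxDl mulmxDr -scalemxAl -scalemxAr xd yd.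
Qed.

Lemma Ext1_enum : exists r : seq (Ext1 M N),
  [/\ uniq r, forall e, e \in r & size r = (#|k| ^ dim_ext M N)%N].
Proof.
have : has_dim_ext M N (dim_ext M N) by apply: xgetPex (has_dim_ext_exists M N).
move=> [phi [[psi phiK psiK] _ _]].
exists [seq phi x | x <- enum 'rV[k]_(dim_ext M N)]; split.
- by rewrite map_inj_uniq ?enum_uniq //; apply: can_inj phiK.
- by move=> e; apply/mapP; exists (psi e); rewrite ?mem_enum ?psiK.
- by rewrite size_map -cardE card_mx mul1n.
Qed.

(** The counts of the extensions by middle term are the multiplicities in one
    list, so they add up to its size, the cardinality of Ext^1. *)
Lemma ext_card_count (r : seq (Ext1 M N)) L : uniq r -> (forall e, e \in r) ->
  ext_card M N L = count_mem L [seq \pi_(c2class A) (emid (repr e)) | e <- r].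
Proof.
move=> ur mr; rewrite count_map -size_filter /ext_card.
apply/perm_size/uniq_perm; [exact: fset_uniq|exact: filter_uniq|].
have fin : finite_set [set e : Ext1 M N | \pi_(c2class A) (emid (repr e)) = L].
  apply: (@sub_finite_set _ _ [set` r]%classic) => [e _|]; first exact: mr.
  exact: finite_seq.
move=> e; rewrite mem_filter mr andbT.
by rewrite in_fset_set // inE /=; apply/asboolP/eqP.
Qed.

End Ext.
End Counting.

Section Zv.
Context (k : finFieldType).

(** q = v^2, and v^-1 lies in the ring. *)
Lemma Zv_q_unit : (#|k|%:R : Zv k) \is a GRing.unit.
Proof.
have q0 : #|k|%:R != 0 :> algC by rewrite pnatr_eq0 -lt0n; apply/card_gt0P; exists 0.
have vV : (vroot k)^-1 \in @Zv_pred k by apply/asboolP => P _ _.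
apply/unitrP; exists (MkZv vV ^+ 2).
have e : MkZv vV ^+ 2 * #|k|%:R = 1.
  apply: val_inj; rewrite rmorphM rmorphXn rmorph_nat rmorph1 /=.
  by rewrite exprVn sqrtCK mulVf.
by split; [exact: e|rewrite mulrC; exact: e].
Qed.

End Zv.

(** * Integration on the twisted Hall algebra *)

Section Integration.
Context (k : finFieldType) (A : falgType k) (n : nat) (S : 'I_n -> amod A).
Context (hA : hereditary A) (hS : simple_system S).
Implicit Types M N : c2p A.

Lemma dimc_iso M N : c2_iso M N -> dimc S M = dimc S N.
Proof.
move=> /asboolP[h [g [[h1 h2 _] _ gh hg]]].
have gh1 := congr1 fst gh; have gh2 := congr1 snd gh.
have hg1 := congr1 fst hg; have hg2 := congr1 snd hg.
rewrite /dimc (dimvec_bij hA hS h1) ?(dimvec_bij hA hS h2) //.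
- by apply/mx_injP; exists g.2.
- by apply/mx_surjP; exists g.2.
- by apply/mx_injP; exists g.1.
- by apply/mx_surjP; exists g.1.
Qed.

(** Needed since the elements of the Hall algebra are classes, evaluated at
    arbitrary representatives. *)
Lemma dimc_repr M : dimc S (repr (\pi_(c2class A) M)) = dimc S M.
Proof. by apply: dimc_iso; apply/eqmodP; rewrite reprK. Qed.

Lemma dimc_emid M N (E : ext M N) : dimc S (emid E) = dimc S M + dimc S N.
Proof.
rewrite /dimc (dimvec_ses hA hS (ext_ses1 E)) (dimvec_ses hA hS (ext_ses2 E)).
by rewrite add_col_mx addrACA -opprD !(addrC (dimvec S (_ N))).
Qed.

Definition integ (x : Htw A) : torus k n :=
  \sum_(c <- msupp x) x@_c *: gmon (Zv k) (dimc S (repr c)).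

(** The support may be enlarged, which makes linearity termwise. *)
Lemma integ_sum (d : {fset c2class A}) (x : Htw A) : fsubset (msupp x) d ->
  integ x = \sum_(c <- d) x@_c *: gmon (Zv k) (dimc S (repr c)).
Proof.
move=> xd; rewrite /integ (big_fset_incl _ xd) // => c _ /mcoeff_outdom ->.
by rewrite scale0r.
Qed.

Lemma integ_linear : linear integ.
Proof.
move=> a x y.
pose d := fsetU (msupp (a *: x + y)) (fsetU (msupp x) (msupp y)).
rewrite !(@integ_sum d) ?fsubsetUl //.
- rewrite scaler_sumr -big_split; apply: eq_bigr => c _ /=.
  by rewrite mcoeffD mcoeffZ scalerDl scalerA.
- by rewrite fsubsetU // fsubsetUr orbT.
- by rewrite fsubsetU // fsubsetUl orbT.
Qed.

HB.instance Definition _ :=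
  GRing.isLinear.Build (Zv k) (Htw A) (torus k n) _ integ integ_linear.

Lemma integZ a x : integ (a *: x) = a *: integ x.
Proof. exact: (linearZ_LR integ). Qed.

Lemma integ_sumE I (r : seq I) (F : I -> Htw A) :
  integ (\sum_(i <- r) F i) = \sum_(i <- r) integ (F i).
Proof. exact: (linear_sum integ). Qed.

Lemma integU c : integ << c >> = gmon (Zv k) (dimc S (repr c)).
Proof.
rewrite (@integ_sum [fset c]%fset) ?msuppU_le // big_seq_fset1 mcoeffUU.
by rewrite scale1r.
Qed.

Lemma integ_cl M : integ (Hcl M) = gmon (Zv k) (dimc S M).
Proof. by rewrite integU dimc_repr. Qed.

Lemma gmonD (a b : 'cV[int]_(n + n)) :
  gmon (Zv k) (a + b) = gmon (Zv k) a * gmon (Zv k) b.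
Proof. by rewrite -[LHS]/(<< a + b >>) -[X in << X *g _ >>]mulr1 -gmulUU. Qed.

(** All middle terms have the same exponent, so the sum of their counts,
    |Ext^1(M, N)| = q^(dim Ext^1), factors out and cancels the Euler form
    together with |Hom(M, N)| = q^(dim Hom). *)
Lemma integ_Hmul_obj M N :
  integ (Hmul_obj M N) = gmon (Zv k) (dimc S M + dimc S N).
Proof.
have [r [ur mr sr]] := Ext1_enum M N.
pose mid (e : Ext1 M N) := \pi_(c2class A) (emid (repr e)).
rewrite /Hmul_obj integZ.
rewrite (@fsbigE _ _ _ _ _ (undup (map mid r))) ?undup_uniq //; last first.
  move=> L _; rewrite mem_undup => Lr.
  by rewrite (ext_card_count _ ur mr) (count_memPn Lr) mul0r scale0r.
rewrite (eq_bigl xpredT); last by move=> L; rewrite in_setT.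
rewrite integ_sumE.
transitivity ((#|k|%:R : Zv k) ^ euler M N *:
    ((\sum_(L <- undup (map mid r)) (ext_card M N L)%:R) / #|homset M N|%:R *:
     gmon (Zv k) (dimc S M + dimc S N))).
  congr (_ *: _); rewrite mulr_suml scaler_suml; apply: eq_big_seq => L.
  rewrite mem_undup => /mapP[e _ ->].
  by rewrite integZ integU /mid dimc_repr dimc_emid.
rewrite -natr_sum (eq_bigr (fun L => count_mem L (map mid r))); last first.
  by move=> L _; apply: ext_card_count.
rewrite sum_count_undup size_map sr card_homset !natrX scalerA.
have uq := Zv_q_unit k.
rewrite /euler exprzDr // -exprnN -exprnP mulrA divrK ?unitrX //.
by rewrite divrr ?unitrX // scale1r.
Qed.

End Integration.

(** * Lifting to the localization *)

Section LocalizationLift.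
Context (R : comNzRingType) (H : lmodType R).
Context (mul : H -> H -> H) (one : H) (I : Type) (s : I -> H).
Context (B : algType R) (f : H -> B) (g : I -> B).
Context (fg : inverting mul one s f g).

Local Notation loc := (loc mul one s).

(** The relation defining the localization identifies expressions with equal
    values in all such B, so evaluating a representative is well defined. *)
Definition loc_lift (x : loc) : B := leval f g (repr x).

Lemma loc_lift_zmod : zmod_morphism loc_lift.
Proof.
move=> x y; rewrite /loc_lift [x - y]/(loc_add x (loc_opp y)) /loc_add /loc_opp.
by rewrite (leval_repr _ fg) /= (leval_repr _ fg).
Qed.

Lemma loc_lift_monoid : monoid_morphism loc_lift.
Proof.
split=> [|x y]; rewrite /loc_lift.
  by rewrite [1]/(loc_gen mul one s one) (leval_repr _ fg) /=; case: fg.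
by rewrite [x * y]/(loc_mul x y) (leval_repr _ fg).
Qed.

Lemma loc_liftZ c x : loc_lift (c *: x) = c *: loc_lift x.
Proof. by rewrite /loc_lift [c *: x]/(loc_scale c x) (leval_repr _ fg). Qed.

Lemma loc_lift_gen x : loc_lift (loc_gen mul one s x) = f x.
Proof. by rewrite /loc_lift (leval_repr _ fg). Qed.

Lemma loc_lift_inv i : loc_lift (loc_inv mul one s i) = g i.
Proof. by rewrite /loc_lift (leval_repr _ fg). Qed.

Lemma loc_lift_exists : exists phi : {rmorphism loc -> B},
  [/\ forall c x, phi (c *: x) = c *: phi x,
      forall x, phi (loc_gen mul one s x) = f x
    & forall i, phi (loc_inv mul one s i) = g i].
Proof.
pose add := GRing.isZmodMorphism.Build _ _ _ loc_lift_zmod.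
pose mon := GRing.isMonoidMorphism.Build _ _ _ loc_lift_monoid.
pose phi : {rmorphism loc -> B} := HB.pack loc_lift add mon.
by exists phi; split; [apply: loc_liftZ|apply: loc_lift_gen|apply: loc_lift_inv].
Qed.

End LocalizationLift.

Section Integral.
Context (k : finFieldType) (A : falgType k) (n : nat) (S : 'I_n -> amod A).
Context (hA : hereditary A) (hS : simple_system S).

Lemma gmon0 : gmon (Zv k) (0 : 'cV[int]_(n + n)) = 1.
Proof. by []. Qed.

Lemma dim_tildeD (a b : 'cV[int]_n) : dim_tilde (a + b) = dim_tilde a + dim_tilde b.
Proof. by rewrite /dim_tilde add_col_mx addr0. Qed.

Lemma dim_tildeN (a : 'cV[int]_n) : dim_tilde (- a) = - dim_tilde a.
Proof. by rewrite /dim_tilde opp_col_mx oppr0. Qed.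

Lemma dimc_Kc (P : pmod A) : dimc S (Kc P) = dim_tilde (dimvec S P).
Proof. by rewrite /dimc subrr. Qed.

Lemma dimc_Zc (P : pmod A) : dimc S (Zc P) = - dim_bar (dimvec S P).
Proof.
by rewrite /dimc /dim_bar opp_col_mx (dimvec0 hA hS (M := zero_amod A)) // sub0r oppr0.
Qed.

Lemma integ_Hmul : {morph integ S : x y / Hmul x y >-> x * y}.
Proof.
move=> x y; rewrite integ_sumE mulr_suml; apply: eq_bigr => M _.
rewrite integ_sumE mulr_sumr; apply: eq_bigr => N _.
rewrite integZ integ_Hmul_obj // gmonD.
by rewrite -scalerAl -scalerAr scalerA.
Qed.

(** X^(tilde P) is the image of [K_P], and monomials are invertible. *)
Lemma integ_inverting : inverting (@Hmul k A) (@Hone k A) (fun P => Hcl (Kc P))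
  (integ S) (fun P => gmon (Zv k) (- dim_tilde (dimvec S P))).
Proof.
split=> [||//|P|P]; first exact: integ_linear.
- have d0 : dimvec S (zero_pmod A) = 0 by apply: dimvec0.
  rewrite (integ_cl hA hS) dimc_Kc d0 /dim_tilde col_mx0; exact: gmon0.
- exact: integ_Hmul.
- by rewrite integ_cl // dimc_Kc -gmonD subrr gmon0.
- by rewrite integ_cl // dimc_Kc -gmonD addNr gmon0.
Qed.

End Integral.

Theorem corollary4p3 (k : finFieldType) (A : falgType k) (n : nat)
    (S : 'I_n -> amod A) (hA : hereditary A) (hS : simple_system S) :
  exists phi : {rmorphism MH A -> torus k n},
    [/\ forall (c : Zv k) (x : MH A), phi (c *: x) = c *: phi x,
        forall (a : 'cV[int]_n) (M : c2p A),
          phi (Kelt S a * MHcl M) = gmon (Zv k) (dim_tilde a + dimc S M),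
        forall a : 'cV[int]_n, phi (Kelt S a) = gmon (Zv k) (dim_tilde a)
      & forall (M : amod A) (P : pmod A),
          phi (Xobj S M P) = gmon (Zv k) (dim_bar (dimvec S M) - dim_bar (dimvec S P))].
Proof.
have [phi [phiZ phi_gen phi_inv]] := loc_lift_exists (integ_inverting hA hS).
have phi_cl (M : c2p A) : phi (MHcl M) = gmon (Zv k) (dimc S M).
  by rewrite phi_gen integ_cl.
have phi_K (a : 'cV[int]_n) : phi (Kelt S a) = gmon (Zv k) (dim_tilde a).
  have [P [Q [aPQ ->]]] : exists P Q : pmod A,
      a = dimvec S P - dimvec S Q /\ Kelt S a = MHcl (Kc P) * Kinv Q.
    rewrite /Kelt; case: xgetP => [_ -> [P [Q [-> ->]]]|]; first by exists P, Q.
    have [P [Q aPQ]] := projective_classes_generate hA hS a.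
    by move=> /(_ (MHcl (Kc P) * Kinv Q)) []; exists P, Q.
  by rewrite rmorphM phi_cl phi_inv -gmonD dimc_Kc -dim_tildeN -dim_tildeD aPQ.
have phi_KM (a : 'cV[int]_n) (M : c2p A) :
    phi (Kelt S a * MHcl M) = gmon (Zv k) (dim_tilde a + dimc S M).
  by rewrite rmorphM phi_K phi_cl -gmonD.
exists phi; split; [exact: phiZ|exact: phi_KM|exact: phi_K|move=> M P].
have [e [ses _]] : exists e, min_resolution (M := M) (C := Cc M) e.
  exact: (xgetPex (Kc (zero_pmod A)) (min_resolution_exists hA M)).
have dimX : dim_tilde (- dimvec S (tgt (Cc M))) + dimc S (Cc M) = dim_bar (dimvec S M).
  (* The lower parts cancel; the upper one is P_M - Omega_M, which is dim M. *)
  rewrite /dim_tilde /dimc /dim_bar add_col_mx add0r addNr; congr col_mx.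
  by rewrite (dimvec_ses hA hS ses) addrC addKr.
have phiX : phi (Xmod S M) = gmon (Zv k) (dim_bar (dimvec S M)).
  by rewrite -dimX -phi_KM.
have phiZP : phi (Xshift P) = gmon (Zv k) (- dim_bar (dimvec S P)).
  by rewrite -(dimc_Zc hA hS) -phi_cl.
rewrite /Xobj rmorphM phiX phiZP; symmetry.
exact: gmonD.
Qed.
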